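(* Let $E\in\mathcal M(I_0,\{n_k\},\{c_k\})$ be a homogeneous Moran set for which there exist two sequences of nonnegative real numbers $\{L_k\}_{k\ge1}$ and $\{R_k\}_{k\ge1}$ such that $\eta_{\sigma,0}=L_{k+1}$ and $\eta_{\sigma,n_{k+1}}=R_{k+1}$ for every $k\ge0$ and every $\sigma\in D_k$. Suppose that $\dim_HE=1$ and that at least one of the following two conditions is satisfied: (A) there exists $\omega_1>0$ such that $\bar\alpha_k\le\omega_1\underline\alpha_k$ for all $k\ge1$; (B) there exists $\omega_2>0$ such that $\bar\alpha_k\le\omega_2\,c_1c_2\cdots c_k$ for all $k\ge1$. Then $\dim_Hf(E)=1$ for every $1$-dimensional quasisymmetric mapping $f$; in particular $E$ is a quasisymmetrically Hausdorff-minimal set.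
   Context: Let $\{n_k\}_{k\ge1}$ be integers with $n_k\ge2$ and $\{c_k\}_{k\ge1}$ positive reals with $n_kc_k<1$ for all $k$. Let $D_0=\{\emptyset\}$ (empty word), $D_k=\{i_1i_2\cdots i_k:1\le i_j\le n_j,\ 1\le j\le k\}$ for $k\ge1$, $D=\bigcup_{k\ge0}D_k$; $\sigma*\tau$ denotes concatenation of words. $|A|$ denotes the diameter of $A\subset\mathbb R$. Homogeneous Moran set: let $I_0=[0,1]$ and let $\{I_\sigma:\sigma\in D\}$ be closed subintervals of $I_0$ such that (1) $I_\emptyset=I_0$; (2) for every $k\ge1$ and $\sigma\in D_{k-1}$, $I_{\sigma*1},\dots,I_{\sigma*n_k}$ are closed subintervals of $I_\sigma$ with $\min(I_{\sigma*(l+1)})\ge\max(I_{\sigma*l})$ for $1\le l\le n_k-1$; (3) for every $k\ge1$, $\sigma\in D_{k-1}$, $1\le i\le n_k$, $|I_{\sigma*i}|/|I_\sigma|=c_k$. Then $E=\bigcap_{k\ge0}\bigcup_{\sigma\in D_k}I_\sigma$ is called a homogeneous Moran set, and $\mathcal M(I_0,\{n_k\},\{c_k\})$ is the class of all such sets (each considered together with its intervals $I_\sigma$). For $k\ge1$, $\sigma\in D_{k-1}$, $1\le i\le n_k-1$ put $\eta_{\sigma,0}=\min(I_{\sigma*1})-\min(I_\sigma)$, $\eta_{\sigma,i}=\min(I_{\sigma*(i+1)})-\max(I_{\sigma*i})$, $\eta_{\sigma,n_k}=\max(I_\sigma)-\max(I_{\sigma*n_k})$. Put $\bar\alpha_k=\max\{\eta_{\sigma,j}:\sigma\in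 D_{k-1},1\le j\le n_k-1\}$, $\underline\alpha_k=\min\{\eta_{\sigma,j}:\sigma\in D_{k-1},1\le j\le n_k-1\}$. A homeomorphism $f:X\to Y$ of metric spaces is quasisymmetric if there is a homeomorphism $\eta:[0,\infty)\to[0,\infty)$ with $\frac{d_Y(f(x),f(a))}{d_Y(f(x),f(b))}\le\eta\!\left(\frac{d_X(x,a)}{d_X(x,b)}\right)$ for all triples $a,b,x$ of distinct points of $X$; it is an $n$-dimensional quasisymmetric mapping if $X=Y=\mathbb R^n$. A set $E\subset\mathbb R^n$ is quasisymmetrically Hausdorff-minimal if $\dim_Hf(E)\ge\dim_HE$ for every $n$-dimensional quasisymmetric mapping $f$ (here $n=1$). $\dim_H$ is Hausdorff dimension. *)

(* Defs.v *)
From HB Require Import structures.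
From mathcomp Require Import all_boot all_order all_algebra.
From mathcomp Require Import all_classical all_reals all_analysis.

Set Implicit Arguments.
Unset Strict Implicit.
Unset Printing Implicit Defensive.

Import Order.TTheory GRing.Theory Num.Theory.
Import numFieldNormedType.Exports.

Local Open Scope classical_set_scope.
Local Open Scope ring_scope.

Section hausdorff_dimension.
Local Open Scope ereal_scope.
Context {R : realType} {X : metricType R}.
Implicit Types (A U : set X) (s d : R).

(* The supremum is taken together with [0], so that the empty set has
   diameter [0] and not [-oo]. *)
Definition diam A : \bar R :=
  ereal_sup (0 |` [set (mdist p.1 p.2)%:E | p in A `*` A]).

(* The term [|U|^s] of a covering sum. The empty set contributes [0] also for
   [s = 0], where the library has [0 `^ 0 = 1]. *)
Definition diam_pow s U : \bar R :=
  if pselect (U = set0) then 0 else poweR (diam U) s.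

Definition countable_cover d A : set ((set X)^nat) :=
  [set U | A `<=` \bigcup_k U k /\ forall k, diam (U k) <= d%:E].

Definition hausdorff_premeasure s d A : \bar R :=
  ereal_inf [set \sum_(0 <= k <oo) diam_pow s (U k) | U in countable_cover d A].

Definition hausdorff_measure s A : \bar R :=
  ereal_sup [set hausdorff_premeasure s d A | d in [set d : R | (0 < d)%R]].

Definition hausdorff_dim A : \bar R :=
  ereal_inf [set s%:E | s in [set s : R | (0 <= s)%R /\
                                          hausdorff_measure s A = 0]].

End hausdorff_dimension.

Definition homeomorphism_between {T U : topologicalType}
    (A : set T) (B : set U) (f : T -> U) : Prop :=
  exists g : U -> T,
    [/\ set_fun A B f /\ set_fun B A g,
        forall x, A x -> g (f x) = x,
        forall y, B y -> f (g y) = y,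
        {within A, continuous f} &
        {within B, continuous g}].

Definition quasisymmetric {R : realType} {X Y : metricType R}
    (f : X -> Y) : Prop :=
  homeomorphism_between setT setT f /\
  exists eta : R -> R,
    homeomorphism_between (`[0, +oo[ : set R) (`[0, +oo[ : set R) eta /\
    forall a b x : X, a <> b -> a <> x -> b <> x ->
      mdist (f x) (f a) / mdist (f x) (f b) <= eta (mdist x a / mdist x b).

(* The notion is meant for Euclidean spaces; for the line, [X] is [R^o]. *)
Definition qs_hausdorff_minimal {R : realType} {X : metricType R}
    (E : set X) : Prop :=
  forall f : X -> X, quasisymmetric f ->
    (hausdorff_dim E <= hausdorff_dim (f @` E))%E.

(* [word n k] is the set of words [i_1 ... i_k] with [1 <= i_j <= n j]. As [nth]
   counts from [0], the letter [i_(j+1)] is [nth 0 s j]. *)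
Definition word (n : nat -> nat) (k : nat) : set (seq nat) :=
  [set s | size s = k /\
           forall j, (j < k)%N -> (1 <= nth 0%N s j <= n j.+1)%N].

(* The interval [I_s] is [`[lo s, hi s]]. The values of the sequences [n] and
   [c] at [0], and of [lo] and [hi] outside the words of [n], are unused. *)
Record moran_family {R : realType} (n : nat -> nat) (c : nat -> R) := {
  lo : seq nat -> R;
  hi : seq nat -> R;
  lo_le_hi : forall k s, word n k s -> lo s <= hi s;
  moran_root : lo [::] = 0 /\ hi [::] = 1;
  moran_sub : forall k s i, word n k s -> (1 <= i <= n k.+1)%N ->
    `[lo (rcons s i), hi (rcons s i)] `<=` `[lo s, hi s];
  moran_ordered : forall k s l, word n k s -> (1 <= l <= (n k.+1).-1)%N ->
    hi (rcons s l) <= lo (rcons s l.+1);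
  moran_ratio : forall k s i, word n k s -> (1 <= i <= n k.+1)%N ->
    (hi (rcons s i) - lo (rcons s i)) / (hi s - lo s) = c k.+1
}.

Section moran.
Context {R : realType} {n : nat -> nat} {c : nat -> R}.
Variable I : moran_family n c.

Definition moran_itv (s : seq nat) : set R^o := `[lo I s, hi I s].

Lemma diam_moran_itv k s : word n k s ->
  diam (moran_itv s) = (hi I s - lo I s)%:E.
Proof.
move=> /(lo_le_hi I) lohi.
apply/eqP; rewrite eq_le; apply/andP; split.
  apply: ge_ereal_sup => _ [->|[[x y] /= [xI yI] <-]].
    by rewrite lee_fin subr_ge0.
  move: xI yI; rewrite /moran_itv /= !in_itv /= => /andP[lx xh] /andP[ly yh].
  by rewrite lee_fin /mdist /= ler_norml opprB !lerB.
apply: ereal_sup_ubound; right; exists (lo I s, hi I s).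
  by split; rewrite /moran_itv /= in_itv /= lexx lohi.
by rewrite /mdist /= ger0_norm // subr_ge0.
Qed.

(* [R^o] is the copy of [R] that carries its metric structure. *)
Definition moran_set : set R^o :=
  \bigcap_k \bigcup_(s in word n k) moran_itv s.

Definition gap (s : seq nat) (j : nat) : R :=
  if j == 0%N then lo I (rcons s 1%N) - lo I s
  else if j == n (size s).+1 then hi I s - hi I (rcons s j)
  else lo I (rcons s j.+1) - hi I (rcons s j).

(* For [k >= 1] and [n k >= 2] this set is finite and nonempty, so that its
   [sup] and [inf] are its maximum and minimum. *)
Definition inner_gaps (k : nat) : set R :=
  [set x | exists s j, [/\ word n k.-1 s, (1 <= j <= (n k).-1)%N & x = gap s j]].

Definition alpha_max (k : nat) : R := sup (inner_gaps k).

Definition alpha_min (k : nat) : R := inf (inner_gaps k).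

End moran.

(* Main.v *)
Require Import Defs.
From HB Require Import structures.
From mathcomp Require Import all_boot all_order all_algebra.
From mathcomp Require Import all_classical all_reals all_analysis.
From mathcomp Require Import zify ring lra.

(* Idea. A quasisymmetric homeomorphism of the line is, up to sign, an
   increasing [g] for which adjacent intervals of equal length have images of
   comparable length (constant [M]); the rest of the control function is not
   needed. If an interval is enlarged by the factor [y], its [g]-image grows by
   at most [(1 + e) * y ^ K(e)], for every [e > 0].

   Let a word pass its mass to its children in proportion to the [g]-length of
   child plus following gap. Along a word of length [k] the mass then exceeds
   the [g]-length of the interval by a product of one-step factors, and (A) or
   (B) bounds each factor by [c_j ^ (-e) * (n_j c_j) ^ (-K)]: either the gap is
   at most a multiple of [(1 - n_j c_j) / (n_j c_j)] times the child, or [n_j]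
   is large and a constant is absorbed by [c_j ^ (-e)]. So the product is at
   most [d_k ^ (-e) * (N_k d_k) ^ (-K)], with [N_k = n_1 ... n_k] and
   [d_k = c_1 ... c_k].

   Let [ess_k] be the length of a level-[k] interval without its end gaps; it
   depends on [k] only. Covering [E] by these hulls, [dim E = 1] gives
   [N_k * ess_k ^ t >= C_t > 0] for all [t < 1], so that [(N_k d_k)^-1] and
   [d_k / ess_k] are [O(ess_k ^ (-e))] for all [e]. As [g] is Hoelder, the mass
   of a word is [O(G ^ s)] for all [s < 1], [G] being the [g]-length of its
   hull. This mass is transported to [`[0, 1[]: a number [t] gets the address
   of the words whose mass intervals contain it, and the point [x(t)] of [E]
   with that address satisfies [|t - u| <= C * |g (x t) - g (x u)| ^ s]. *)

Set Implicit Arguments.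
Unset Strict Implicit.
Unset Printing Implicit Defensive.

Import Order.TTheory GRing.Theory Num.Theory.
Import numFieldNormedType.Exports.
Local Open Scope classical_set_scope.
Local Open Scope ring_scope.

(** * Quasisymmetric maps of the line *)

Lemma pow2_bracket {R : realType} (y : R) : 1 <= y ->
  exists j : nat, 2 ^+ j <= y /\ y < 2 ^+ j.+1.
Proof.
move=> y1; have y0 : 0 <= y by lra.
have := @truncn_itv R y y0; set m := Num.truncn y => /andP[my ym].
have m0 : (0 < m)%N by rewrite -(ltr_nat R) -[_%:R]/0; move: ym; rewrite -natr1; lra.
have /andP[le_m m_lt] := trunc_log_bounds (isT : (1 < 2)%N) m0.
exists (trunc_log 2 m); split.
  by apply: le_trans my; rewrite -natrX ler_nat.
by apply: lt_le_trans ym _; rewrite -natrX ler_nat.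
Qed.

Lemma bernoulli_ge {R : realType} (u : R) (m : nat) : 0 <= u ->
  1 + m%:R * u <= (1 + u) ^+ m.
Proof.
move=> u0; elim: m => [|m IH]; first by rewrite mul0r addr0 expr0.
rewrite exprS -natr1; have := ler0n R m; nra.
Qed.

Lemma expr_unbounded {R : realType} (u z : R) : 0 < u ->
  exists m : nat, z <= (1 + u) ^+ m.
Proof.
move=> u0; have [z0|z0] := lerP z 0.
  by exists 0%N; rewrite expr0; lra.
exists (Num.bound (z / u)); apply: le_trans (bernoulli_ge _ (ltW u0)).
have /archi_boundP : 0 <= z / u by rewrite divr_ge0 ?ltW.
by rewrite ltr_pdivrMr //; lra.
Qed.

Section line_quasisymmetry.
Context {R : realType}.
Implicit Types (g : R -> R) (M : R).

(** The Beurling-Ahlfors condition. Both directions are demanded, which keeps the class stable under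
    the reflection in [line_qs_flip]. *)
Definition line_qs M g : Prop :=
  [/\ 0 < M, {homo g : x y / x < y} &
      forall x h, 0 < h ->
        g (x + h) - g x <= M * (g x - g (x - h)) /\
        g x - g (x - h) <= M * (g (x + h) - g x)].

Lemma line_qs_flip M g : line_qs M g -> line_qs M (fun x => - g (- x)).
Proof.
move=> [M0 gi gM]; split=> // [x y xy|x h h0].
  by rewrite ltrN2; apply: gi; rewrite ltrN2.
have [] := gM (- x) h h0.
by rewrite !opprD !opprK; lra.
Qed.

Lemma line_qs_le M g : line_qs M g -> {homo g : x y / x <= y}.
Proof. by move=> [_ gi _]; apply: ltW_homo. Qed.

(** The half added by each doubling has image at most [M] times that of the half already there. *)
Lemma line_qs_double M g a l m : line_qs M g -> 0 < l ->
  g (a + 2 ^+ m * l) - g a <= (1 + M) ^+ m * (g (a + l) - g a).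
Proof.
move=> [M0 _ gM] l0; elim: m => [|m IH]; first by rewrite !expr0 !mul1r.
have [] := gM (a + 2 ^+ m * l) (2 ^+ m * l) _.
  by rewrite mulr_gt0 ?exprn_gt0.
have -> : a + 2 ^+ m * l + 2 ^+ m * l = a + 2 ^+ m.+1 * l by rewrite exprS; ring.
rewrite addrK [(1 + M) ^+ _]exprS -mulrA => + _.
by move: IH; set T := (_ ^+ m * _); nra.
Qed.

(** Of two equal halves, the one next to [b] carries at most the fraction [M / (1 + M)] of the
    image; this repeats under bisection. *)
Lemma line_qs_half M g b l m : line_qs M g -> 0 < l ->
  g b - g (b - l / 2 ^+ m) <= (M / (1 + M)) ^+ m * (g b - g (b - l)).
Proof.
move=> [M0 _ gM] l0; elim: m => [|m IH]; first by rewrite !expr0 mul1r divr1.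
set h := l / 2 ^+ m.+1.
have hE : l / 2 ^+ m = h + h.
  by rewrite /h exprS; field; rewrite expf_neq0.
have [] := gM (b - h) h _; first by rewrite divr_gt0 ?exprn_gt0.
rewrite subrK -addrA -opprD -hE => + _.
move: IH; set D := g b - _; set T := (_ ^+ m * _) => IH hh.
rewrite exprS -mulrA -/T.
rewrite mulrAC ler_pdivlMr; last by lra.
rewrite /D in IH; nra.
Qed.

(** The leading constant must be close to 1, as it is paid once per level along a word. A tiny
    enlargement adds at most the fraction [e] to the image, by repeated halving. Any other one has
    ratio at least [1 + 2 ^- m], and a power of that ratio pays for the doubling estimate. *)
Lemma line_qs_stretch_right M (e : R) : 0 < M -> 0 < e -> exists K : nat,
  forall g a b c, line_qs M g -> a < b -> b <= c ->
    g c - g a <= (1 + e) * ((c - a) / (b - a)) ^+ K * (g b - g a).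
Proof.
move=> M0 e0.
have [m hm] : exists m : nat, M * (M / (1 + M)) ^+ m <= e.
  have Mi : 0 < M^-1 by rewrite invr_gt0.
  have [m hm] := expr_unbounded (M / e) Mi.
  exists m; have -> : M / (1 + M) = (1 + M^-1)^-1.
    by field; rewrite gt_eqF //; lra.
  by rewrite exprVn ler_pdivrMr ?exprn_gt0 ?addr_gt0 ?invr_gt0 // -ler_pdivrMl // mulrC.
(* [K1] bounds [1 + M] by a power of 2; [K2] covers the extra factor [2 ^+ K1] lost in rounding the
   ratio up to [2 ^+ j.+1]. *)
have [K1 hK1] := expr_unbounded (1 + M) (ltr01 : 0 < 1 :> R).
have u0 : 0 < 2 ^- m :> R by rewrite invr_gt0 exprn_gt0.
have [K2 hK2] := expr_unbounded (2 ^+ K1) u0.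
exists (K2 + K1)%N => g a b c gq ab bc.
have gab : g a < g b by case: gq => _ gi _; apply: gi.
set y := (c - a) / (b - a).
have y1 : 1 <= y by rewrite ler_pdivlMr; lra.
have [small|large] := lerP (c - b) ((b - a) / 2 ^+ m).
  have gcb : g c - g b <= e * (g b - g a).
    (* The overhang is compared with its reflection at [b], which lies in the last piece of length
       [h] of the interval from [a] to [b]. *)
    set h := (b - a) / 2 ^+ m.
    have h0 : 0 < h by rewrite divr_gt0 ?exprn_gt0 ?subr_gt0.
    have [_ _ gM] := gq; have [gbh _] := gM b h h0.
    have gch : g c <= g (b + h) by apply: (line_qs_le gq); rewrite /h; lra.
    have := @line_qs_half M g b (b - a) m gq; rewrite subr_gt0 -/h => /(_ ab).
    rewrite opprB addrCA subrr addr0 => gbhm.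
    apply: (@le_trans _ _ (M * (M / (1 + M)) ^+ m * (g b - g a))); last first.
      by rewrite ler_wpM2r ?subr_ge0 ?(ltW gab).
    rewrite -mulrA; apply: le_trans (_ : M * (g b - g (b - h)) <= _); first lra.
    by rewrite ler_pM2l.
  apply: (@le_trans _ _ ((1 + e) * (g b - g a))); first by lra.
  have yK : 1 <= y ^+ (K2 + K1) by exact: exprn_ege1.
  by apply: ler_wpM2r; [lra|nra].
have [j [jy yj]] := pow2_bracket y1.
apply: (@le_trans _ _ ((1 + M) ^+ j.+1 * (g b - g a))).
  have := @line_qs_double M g a (b - a) j.+1 gq.
  rewrite subr_gt0 => /(_ ab); rewrite [a + (b - a)]addrC subrK.
  apply: le_trans; rewrite lerB // (line_qs_le gq) // -lerBlDl.
  by rewrite -ler_pdivrMr ?subr_gt0 // ltW.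
rewrite ler_wpM2r ?subr_ge0 ?(ltW gab) //.
apply: (@le_trans _ _ (y ^+ (K2 + K1))); last first.
  by rewrite ler_peMl ?exprn_ge0; lra.
apply: (@le_trans _ _ ((2 ^+ j.+1) ^+ K1)).
  rewrite exprAC; apply: lerXn2r; rewrite ?nnegrE; [lra|by rewrite exprn_ge0|].
  by [].
rewrite exprD exprS exprMn; apply: ler_pM; rewrite ?exprn_ge0 //.
  apply: le_trans hK2 _; apply: lerXn2r; rewrite ?nnegrE; [lra|lra|].
  rewrite /y ler_pdivlMr ?subr_gt0 // mulrDl [2 ^- m * _]mulrC; lra.
by apply: lerXn2r; rewrite ?nnegrE ?exprn_ge0 //; lra.
Qed.

Lemma line_qs_stretch_left M (e : R) : 0 < M -> 0 < e -> exists K : nat,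
  forall g a b c, line_qs M g -> a <= b -> b < c ->
    g c - g a <= (1 + e) * ((c - a) / (c - b)) ^+ K * (g c - g b).
Proof.
move=> M0 /(line_qs_stretch_right M0)[K hK]; exists K => g a b c gq ab bc.
have := hK _ (- c) (- b) (- a) (line_qs_flip gq).
rewrite ltrN2 lerN2 !opprK => /(_ bc ab).
have shift (x y : R) : - x + y = y - x by rewrite addrC.
by rewrite !shift.
Qed.

(** The interval is extended first to the right and then to the left; each of the two ratios is at
    most the total one. *)
Lemma line_qs_stretch M (e : R) : 0 < M -> 0 < e -> exists K : nat,
  forall g a a' b' b, line_qs M g -> a <= a' -> a' < b' -> b' <= b ->
    g b - g a <= (1 + e) * ((b - a) / (b' - a')) ^+ K * (g b' - g a').
Proof.
move=> M0 e0; pose z := Num.min 1 (e / 3).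
have z0 : 0 < z by rewrite lt_min; apply/andP; split; lra.
have ze : (1 + z) * (1 + z) <= 1 + e.
  have : z <= 1 by rewrite ge_min lexx.
  have : z <= e / 3 by rewrite ge_min lexx orbT.
  by nra.
have [K1 hK1] := line_qs_stretch_right M0 z0.
have [K2 hK2] := line_qs_stretch_left M0 z0.
exists (K1 + K2)%N => g a a' b' b gq aa ab bb.
have ab0 : 0 < b' - a' by rewrite subr_gt0.
have gab : 0 < g b' - g a' by rewrite subr_gt0; case: gq => _ gi _; apply: gi.
set y := (b - a) / (b' - a').
have ratio x x' : 0 < x' -> 0 <= x -> x <= b - a -> b' - a' <= x' ->
    0 <= x / x' <= y.
  move=> x'0 x0 xb x'b; rewrite divr_ge0 ?(ltW x'0) //=.
  by apply: ler_pM => //; rewrite ?invr_ge0 ?(ltW x'0) // lef_pV2 ?posrE.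
have y0 : 0 <= y by have /andP[/le_trans h /h] := ratio _ _ ab0 (ltW ab0) ltac:(lra) (lexx _).
have h1 := hK1 _ _ _ _ gq ab bb.
have h2 : g b - g a <= _ := hK2 _ a a' b gq aa (lt_le_trans ab bb).
apply: le_trans h2 _.
have /andP[r20 r2] : 0 <= (b - a) / (b - a') <= y by apply: ratio; lra.
have /andP[r10 r1] : 0 <= (b - a') / (b' - a') <= y by apply: ratio; lra.
apply: (@le_trans _ _ ((1 + z) * y ^+ K2 * ((1 + z) * y ^+ K1 * (g b' - g a')))).
  apply: ler_pM.
  - by rewrite mulr_ge0 ?exprn_ge0 //; lra.
  - by rewrite subr_ge0 (line_qs_le gq) //; lra.
  - by rewrite ler_pM2l ?lerXn2r //; lra.
  - by apply: le_trans h1 _; rewrite ler_pM2r // ler_pM2l ?lerXn2r //; lra.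
have -> : (1 + z) * y ^+ K2 * ((1 + z) * y ^+ K1 * (g b' - g a')) =
    (1 + z) * (1 + z) * (y ^+ (K1 + K2) * (g b' - g a')) by rewrite exprD; ring.
rewrite -[X in _ <= X]mulrA; apply: ler_wpM2r => //.
by rewrite mulr_ge0 ?exprn_ge0 // ltW.
Qed.

(** By monotonicity one of the intervals may be replaced by one as long as its neighbour. *)
Lemma line_qs_adjacent M g a b c : line_qs M g -> a < b ->
  (b - a <= c - b -> g b - g a <= M * (g c - g b)) /\
  (c - b <= b - a -> g c - g b <= M * (g b - g a)).
Proof.
move=> gq ab; have [M0 _ gM] := gq.
have ba : 0 < b - a by rewrite subr_gt0.
have bba : b - (b - a) = a by ring.
split => h; have [] := gM b _ ba; rewrite bba => g1 g2.
  apply: le_trans g2 _.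
  by rewrite ler_pM2l // lerB // (line_qs_le gq) //; lra.
apply: le_trans g1.
by rewrite lerB // (line_qs_le gq) //; lra.
Qed.

Lemma line_qs_holder M g : line_qs M g -> exists q C : R,
  [/\ 0 < q, 0 < C & forall a b, 0 <= a -> a < b -> b <= 1 ->
     g b - g a <= C * (b - a) `^ q].
Proof.
move=> gq; have [M0 gi gM] := gq.
set th := M / (1 + M).
have th0 : 0 < th by rewrite divr_gt0 //; lra.
have th1 : th < 1 by rewrite /th ltr_pdivrMr; lra.
have ln2 : 0 < ln (2 : R) by rewrite ln_gt0 //; lra.
(* The exponent solves [2^(-q) = th], so one bisection gains exactly the factor [2^(-q)]. *)
pose q := - ln th / ln 2.
have q0 : 0 < q by rewrite divr_gt0 // oppr_gt0 ln_lt0 // th0.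
have thE : th = 2 `^ (- q).
  by rewrite /powR pnatr_eq0 /= mulNr divfK ?gt_eqF // opprK lnK.
have D0 : 0 < g 1 - g (-1) by rewrite subr_gt0; apply: gi; lra.
exists q, (2 `^ q * (g 1 - g (-1))); split=> // [|a b a0 ab b1].
  by rewrite mulr_gt0 // powR_gt0.
set x := b - a; have x0 : 0 < x by rewrite subr_gt0.
(* Now [2^(-j-1) < x <= 2^(-j)]. The interval of length [2^(-j)] ending at [b] contains the given
   one, and [b - 1 >= -1]; rounding [x] costs the factor [2^q]. *)
have [j [jx xj]] : exists j : nat, 2 ^+ j <= x^-1 /\ x^-1 < 2 ^+ j.+1.
  by apply: pow2_bracket; rewrite invf_ge1 // /x; lra.
have xle : x <= 1 / 2 ^+ j.
  by rewrite ler_pdivlMr ?exprn_gt0 // -ler_pdivlMl // mulr1.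
have xgt : 2 ^- j <= 2 * x.
  rewrite -[2 ^- j]mul1r ler_pdivrMr ?exprn_gt0 //.
  by move: xj; rewrite exprS -[x^-1]mul1r ltr_pdivrMr // => /ltW; lra.
have hj := @line_qs_half M g b 1 j gq ltr01.
apply: (@le_trans _ _ (g b - g (b - 1 / 2 ^+ j))).
  by rewrite lerB // (line_qs_le gq) // lerBlDr -lerBlDl.
apply: le_trans hj _.
apply: (@le_trans _ _ (th ^+ j * (g 1 - g (-1)))).
  apply: ler_wpM2l; first by rewrite exprn_ge0 ?ltW.
  by rewrite lerB // (line_qs_le gq) //; lra.
rewrite mulrAC ler_pM2r // -powRM //; last by rewrite ltW.
have -> : th ^+ j = (2 ^- j) `^ q.
  rewrite thE -(powR_mulrn j (powR_ge0 2 (- q))) -(powR_mulrn j (ler0n R 2)).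
  by rewrite -powRN -!powRrM; congr (_ `^ _); rewrite !mulNr mulrC.
have j0 : 0 < 2 ^- j :> R by rewrite invr_gt0 exprn_gt0.
by apply: ge0_ler_powR; rewrite ?nnegrE; lra.
Qed.

End line_quasisymmetry.

(** * Hausdorff measures *)

Section hausdorff_estimates.
Context {R : realType} {X : metricType R}.
Implicit Types (A U : set X) (s d : R).
Local Open Scope ereal_scope.

Lemma diam_ge0 A : 0 <= diam A.
Proof. by apply: ereal_sup_ubound; left. Qed.

Lemma mdist_le_diam A x y : A x -> A y -> (mdist x y)%:E <= diam A.
Proof. by move=> Ax Ay; apply: ereal_sup_ubound; right; exists (x, y). Qed.

Lemma diam_set0 : diam (set0 : set X) = 0.
Proof.
apply/eqP; rewrite eq_le diam_ge0 andbT; apply: ge_ereal_sup => y [->//|].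
by move=> [p [[]]].
Qed.

Lemma diam_pow_ge0 s U : 0 <= diam_pow s U.
Proof. by rewrite /diam_pow; case: pselect => //= _; exact: poweR_ge0. Qed.

Lemma diam_powE s U : (0 < s)%R -> diam_pow s U = poweR (diam U) s.
Proof.
move=> s0; rewrite /diam_pow; case: pselect => //= U0.
by rewrite U0 diam_set0 poweR0r ?gt_eqF.
Qed.

Lemma hausdorff_premeasure_ge0 s d A : 0 <= hausdorff_premeasure s d A.
Proof.
apply: le_ereal_inf_tmp => _ [U _ <-]; apply: nneseries_ge0 => k _ _.
exact: diam_pow_ge0.
Qed.

Lemma hausdorff_premeasure_le s d A : (0 < d)%R ->
  hausdorff_premeasure s d A <= hausdorff_measure s A.
Proof. by move=> d0; apply: ereal_sup_ubound; exists d. Qed.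

Lemma hausdorff_premeasure_le_finite s d A (U : nat -> set X) m l :
  (0 < s)%R -> (0 <= l <= d)%R ->
  A `<=` \bigcup_(k in `I_m) U k ->
  (forall k, (k < m)%N -> diam (U k) <= l%:E) ->
  hausdorff_premeasure s d A <= (m%:R * l `^ s)%:E.
Proof.
move=> s0 /andP[l0 ld] AU Ul.
(* The finite family is padded with empty sets, whose [diam_pow] is 0. *)
pose V k := if (k < m)%N then U k else set0.
have V0 k : (m <= k)%N -> V k = set0 by move=> mk; rewrite /V ltnNge mk.
apply: (@le_trans _ _ (\sum_(0 <= k <oo) diam_pow s (V k))).
  apply: ereal_inf_lbound; exists V => //; split=> [x /AU[k km Ux]|k].
    by exists k => //; rewrite /V (km : (k < m)%N).
  rewrite /V; case: ifPn => [/Ul/le_trans|_]; last by rewrite diam_set0 lee_fin (le_trans l0).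
  by apply; rewrite lee_fin.
rewrite (nneseries_split 0 m) ?add0n => [|k _]; last exact: diam_pow_ge0.
rewrite [X in _ + X]eseries0 ?adde0 => [|k mk _]; last first.
  by rewrite V0 // /diam_pow; case: pselect.
apply: (@le_trans _ _ (\sum_(0 <= k < m) (l `^ s)%:E)).
  rewrite !big_nat; apply: lee_sum => k /andP[_ km].
  rewrite diam_powE // -poweR_EFin; apply: gt0_ler_poweR; first exact: ltW.
  - by rewrite in_itv /= diam_ge0 leey.
  - by rewrite in_itv /= lee_fin l0 leey.
  - by rewrite /V km Ul.
by rewrite sumEFin lee_fin big_const_nat iter_addr subn0 addr0 mulr_natl.
Qed.

(** Lebesgue measure on the unit interval plays the role of the mass. A covering set of diameter [r]
    pulls back under [h] to a set of diameter at most [C * r^s]; enclosing these preimages in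
    intervals gives a cover of total length at least 1. *)
Lemma mass_distribution s (C : R) A (h : R -> X) : (0 < s)%R -> (0 < C)%R ->
  (forall t : R, (0 <= t < 1)%R -> A (h t)) ->
  (forall t u : R, (0 <= t < 1)%R -> (0 <= u < 1)%R ->
    (`|t - u| <= C * mdist (h t) (h u) `^ s)%R) ->
  (C^-1)%:E <= hausdorff_premeasure s 1 A.
Proof.
move=> s0 C0 hA hC; apply: le_ereal_inf_tmp => _ [U [AU U1] <-].
have Ufin k : diam (U k) \is a fin_num.
  by rewrite ge0_fin_numE ?diam_ge0 // (le_lt_trans (U1 k)) ?ltry.
pose r k := (C * fine (diam (U k)) `^ s)%R.
have r0 k : (0 <= r k)%R by rewrite mulr_ge0 ?powR_ge0 // ltW.
pose T k := [set t : R | (0 <= t < 1)%R /\ U k (h t)].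
have Tr k t u : T k t -> T k u -> (t - u <= r k)%R.
  move=> [t01 ht] [u01 hu]; apply: le_trans (ler_norm _) _.
  apply: le_trans (hC _ _ t01 u01) _.
  rewrite ler_pM2l //; apply: ge0_ler_powR; rewrite ?nnegrE ?(ltW s0) ?mdist_ge0 //.
    by rewrite fine_ge0 ?diam_ge0.
  by rewrite -lee_fin fineK // mdist_le_diam.
(* For an empty [T k] the infimum is a default value, but the inclusion is then trivial and the
   length of [J k] is still at most [r k]. *)
pose J k : set R := [set` `[inf (T k), (inf (T k) + r k)%R]%R].
have TJ k : T k `<=` J k.
  move=> t Tt; rewrite /J /= in_itv /=.
  have lbT : has_lbound (T k) by exists 0%R => u [/andP[]].
  rewrite (ge_inf lbT Tt) /= -lerBlDr; apply: lb_le_inf; first by exists t.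
  by move=> u Tu; rewrite lerBlDr -lerBlDl; apply: Tr.
have mJ k : measurable (J k) by exact: measurable_itv.
have cover : [set` `[0%R, 1%R[%R : interval R] `<=` \bigcup_k J k.
  move=> t; rewrite /= in_itv /= => t01.
  by have [k _ Uk] := AU _ (hA _ t01); exists k => //; apply: TJ; split.
have := measure_sigma_subadditive (@lebesgue_measure R) mJ (measurable_itv _) cover.
rewrite [X in X <= _](_ : _ = 1); last first.
  by apply: etrans (lebesgue_measure_itv _) _; rewrite /= lte_fin ltr01 oppr0 adde0.
move=> le1; rewrite -(@lee_pmul2l _ C%:E) ?lte_fin // -EFinM divff ?gt_eqF //.
rewrite -nneseriesZl; last by move=> *; exact: diam_pow_ge0.
apply: le_trans le1 _; apply: lee_nneseries => [k _ _|k _]; first exact: measure_ge0.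
rewrite diam_powE // -[diam _]fineK // poweR_EFin -EFinM -/(r k).
have LJ : (@lebesgue_measure R) (J k) =
    if (inf (T k) < inf (T k) + r k)%R then (r k)%:E else 0.
  apply: etrans (lebesgue_measure_itv _) _.
  by rewrite /= lte_fin; case: ifP => // _; rewrite -EFinD addrAC subrr add0r.
by rewrite [X in X <= _]LJ; case: ifP => // _; rewrite lee_fin.
Qed.

(** At scale 1 no diameter exceeds 1, so a larger exponent makes each term smaller. *)
Lemma hausdorff_premeasure_exponent s t A : (0 <= s)%R -> (s <= t)%R ->
  hausdorff_premeasure t 1 A <= hausdorff_premeasure s 1 A.
Proof.
move=> s0 st; apply: le_ereal_inf_tmp => _ [U [AU U1] <-].
apply: (@le_trans _ _ (\sum_(0 <= k <oo) diam_pow t (U k))).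
  by apply: ereal_inf_lbound; exists U.
apply: lee_nneseries => k _ => [_|]; first exact: diam_pow_ge0.
rewrite /diam_pow; case: pselect => //= _.
have Ufin : diam (U k) \is a fin_num.
  by rewrite ge0_fin_numE ?diam_ge0 // (le_lt_trans (U1 k)) ?ltry.
have := U1 k; rewrite -[diam _]fineK // !poweR_EFin !lee_fin.
have : (0 <= fine (diam (U k)))%R by rewrite fine_ge0 ?diam_ge0.
move: (fine _) => x; rewrite le_eqVlt => /predU1P[<- _|x0 x1].
  (* Diameter 0 needs care because [0^0 = 1]: if [t = 0] then [s = 0] as well. *)
  have [t0|t0] := eqVneq t 0%R; last by rewrite powR0 // powR_ge0.
  by rewrite (_ : s = t) //; apply/eqP; rewrite eq_le st t0.
by apply: ger_powR => //; rewrite x0.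
Qed.

Lemma hausdorff_dim_lt s A : (0 <= s)%R -> s%:E < hausdorff_dim A ->
  exists2 d : R, (0 < d)%R & 0 < hausdorff_premeasure s d A.
Proof.
move=> s0 sA; have [//|none] := pselect (exists2 d : R, (0 < d)%R &
  0 < hausdorff_premeasure s d A).
suff H0 : hausdorff_measure s A = 0.
  have : hausdorff_dim A <= s%:E by apply: ereal_inf_lbound; exists s.
  by rewrite leNgt sA.
apply/eqP; rewrite eq_le; apply/andP; split.
  apply: ge_ereal_sup => _ [d d0 <-].
  by rewrite leNgt; apply/negP => pos; apply: none; exists d.
apply: le_trans (hausdorff_premeasure_ge0 s 1%R A) _.
exact: hausdorff_premeasure_le ltr01.
Qed.

Lemma le_hausdorff_dim (D : R) A :
  (forall s, (0 < s < D)%R -> 0 < hausdorff_premeasure s 1 A) ->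
  D%:E <= hausdorff_dim A.
Proof.
move=> posA; apply: le_ereal_inf_tmp => _ [s [s0 Hs] <-].
rewrite lee_fin leNgt; apply/negP => sD.
(* The midpoint is strictly positive even when [s = 0], so [posA] applies to it. *)
suff : hausdorff_premeasure ((s + D) / 2) 1 A <= 0 by rewrite leNgt posA //; lra.
rewrite -Hs; apply: le_trans (hausdorff_premeasure_le s A ltr01).
by apply: hausdorff_premeasure_exponent => //; lra.
Qed.

End hausdorff_estimates.

Lemma diam_le_itv {R : realType} (A : set R^o) (a b : R) : a <= b ->
  A `<=` [set` `[a, b]] -> (diam A <= (b - a)%:E)%E.
Proof.
move=> ab Aab; apply: ge_ereal_sup => y [->|[[u v] [/= Au Av] <-]].
  by rewrite lee_fin subr_ge0.
move: (Aab _ Au) (Aab _ Av).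
rewrite /= !in_itv /= => /andP[au ub] /andP[av vb].
by rewrite lee_fin /mdist /= ler_norml; lra.
Qed.

(** Cutting the interval into [m] equal pieces gives the covering sum [l^(1+e) * m^(-e)], which
    tends to 0. *)
Lemma hausdorff_dim_le1 {R : realType} (A : set R^o) (a b : R) : a < b ->
  A `<=` [set` `[a, b]] -> (hausdorff_dim A <= 1)%E.
Proof.
move=> ab Aab; apply/lee_addgt0Pr => e e0; rewrite -EFinD.
apply: ereal_inf_lbound; exists (1 + e) => //; split; first by lra.
apply/eqP; rewrite eq_le; apply/andP; split; last first.
  apply: le_trans (hausdorff_premeasure_ge0 _ 1 A) _.
  exact: hausdorff_premeasure_le ltr01.
apply: ge_ereal_sup => _ [d /= d0 <-].
pose l : R := b - a; have l0 : 0 < l by rewrite subr_gt0.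
have mbound m : (0 < m)%N -> l / m%:R <= d ->
    (hausdorff_premeasure (1 + e) d A <= (l `^ (1 + e) * m%:R `^ (- e))%:E)%E.
  move=> m0 md; have mR : 0 < m%:R :> R by rewrite ltr0n.
  pose U k : set R^o := [set` `[a + k%:R * (l / m%:R), a + k.+1%:R * (l / m%:R)]].
  have lm0 : 0 < l / m%:R by rewrite divr_gt0.
  have := @hausdorff_premeasure_le_finite _ _ (1 + e) d A U m (l / m%:R).
  have -> : m%:R * (l / m%:R) `^ (1 + e) = l `^ (1 + e) * m%:R `^ (- e).
    rewrite powRM ?invr_ge0 ?(ltW l0) ?(ltW mR) // mulrCA; congr (_ * _).
    rewrite -powR_inv1 ?(ltW mR) // -powRrM mulN1r !powRN.
    rewrite powRD ?(gt_eqF mR) ?implybT // powRr1 ?(ltW mR) // invfM mulrA.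
    by rewrite divff ?gt_eqF // mul1r.
  apply=> //; first by lra.
  - by rewrite ltW.
  - move=> x Ax; have := Aab x Ax; rewrite /= in_itv /= => /andP[ax xb].
    (* The right endpoint goes into the last piece; truncation would give it the index [m], one too
       many. *)
    have [xb'|xb'] := eqVneq x b.
      exists m.-1 => /=; first by rewrite ltn_predL.
      rewrite /U /= in_itv /= prednK // xb'.
      have -> : m%:R * (l / m%:R) = l by field; rewrite gt_eqF.
      apply/andP; split; last by rewrite /l; lra.
      have : m.-1%:R * (l / m%:R) <= l.
        by rewrite mulrA ler_pdivrMr // mulrC ler_pM2l // ler_nat leq_pred.
      by rewrite /l; lra.
    have xm0 : 0 <= (x - a) / (l / m%:R) by rewrite divr_ge0 ?subr_ge0 // ltW.
    exists (Num.truncn ((x - a) / (l / m%:R))).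
      rewrite /= -(ltr_nat R); apply: le_lt_trans (_ : (x - a) / (l / m%:R) < _).
        by have /andP[] := truncn_itv xm0.
      rewrite ltr_pdivrMr // mulrC divfK ?gt_eqF // /l ltrD2r.
      by rewrite lt_neqAle xb' xb.
    rewrite /U /= in_itv /=; have /andP[] := truncn_itv xm0.
    by rewrite ler_pdivlMr // ltr_pdivrMr // => ? /ltW ?; apply/andP; split; lra.
  - move=> k km; have ab' : a + k%:R * (l / m%:R) <= a + k.+1%:R * (l / m%:R).
      by rewrite lerD2l ler_pM2r // ler_nat.
    have := diam_le_itv ab' (@subset_refl _ (U k)); move/le_trans; apply.
    by rewrite lee_fin -natr1; lra.
apply/lee_addgt0Pr => z z0; rewrite add0e.
(* The first summand makes the pieces no longer than [d], the second makes the covering sum at most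
   [z]. *)
pose m := (Num.bound (l / d) + Num.bound ((z / l `^ (1 + e)) `^ (- e^-1))).+1.
have mR : 0 < m%:R :> R by rewrite ltr0n.
apply: le_trans (mbound m _ _) _ => //.
  rewrite ler_pdivrMr // mulrC -ler_pdivrMr // /m.
  have /archi_boundP/ltW/le_trans : 0 <= l / d by rewrite divr_ge0 ?ltW.
  by apply; rewrite ler_nat leqW ?leq_addr.
have le0 : 0 < l `^ (1 + e) by rewrite powR_gt0.
rewrite lee_fin mulrC -ler_pdivlMr //.
set w := z / _; have w0 : 0 < w by rewrite divr_gt0.
have -> : w = (w `^ (- e^-1)) `^ (- e).
  by rewrite -powRrM mulrN mulNr opprK mulVf ?gt_eqF // powRr1 // ltW.
rewrite !powRN lef_pV2 ?posrE ?powR_gt0 ?invr_gt0 ?powR_gt0 //.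
apply: ge0_ler_powR; rewrite ?nnegrE ?powR_ge0 ?(ltW e0) ?(ltW mR) ?invr_ge0 ?powR_ge0 //.
have /archi_boundP/ltW := powR_ge0 w (- e^-1); rewrite powRN => /le_trans; apply.
by rewrite ler_nat /m powRN leqW ?leq_addl.
Qed.

(** * Geometry of homogeneous Moran sets *)

Lemma uniform_lower_bound {R : realType} (a : nat -> R) (k0 : nat) (b : R) :
  (forall k, 0 < a k) -> 0 < b -> (forall k, (k0 <= k)%N -> b <= a k) ->
  exists2 C : R, 0 < C & forall k, C <= a k.
Proof.
move=> a0; elim: k0 b => [|k0 IH] b b0 hb; first by exists b => // k; exact: hb.
apply: (IH (Num.min b (a k0))); first by rewrite lt_min b0 a0.
move=> k; rewrite leq_eqVlt ge_min => /predU1P[<-|/hb ->]; rewrite ?lexx ?orbT //.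
Qed.

Section moran_geometry.
Context (R : realType) (n : nat -> nat) (c : nat -> R).
Context (n_ge2 : forall k, (1 <= k)%N -> (2 <= n k)%N).
Context (c_gt0 : forall k, (1 <= k)%N -> 0 < c k).
Context (nc_lt1 : forall k, (1 <= k)%N -> (n k)%:R * c k < 1).
Context (I : moran_family n c).

Definition moran_len k : R := \prod_(1 <= j < k.+1) c j.

Definition moran_count k : nat := \prod_(1 <= j < k.+1) n j.

(* The left endpoints of the children of [I_s], followed by the right endpoint
   of the last child. *)
Definition child_pt (s : seq nat) (j : nat) : R :=
  if (j <= n (size s).+1)%N then lo I (rcons s j)
  else hi I (rcons s (n (size s).+1)).

Lemma moran_lenS k : moran_len k.+1 = c k.+1 * moran_len k.
Proof. by rewrite /moran_len big_nat_recr //= mulrC. Qed.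

Lemma moran_countS k : moran_count k.+1 = (moran_count k * n k.+1)%N.
Proof. by rewrite /moran_count big_nat_recr. Qed.

Lemma moran_len_gt0 k : 0 < moran_len k.
Proof.
elim: k => [|k IH]; first by rewrite /moran_len big_geq.
by rewrite moran_lenS mulr_gt0 ?c_gt0.
Qed.

Lemma moran_count_gt0 k : (0 < moran_count k)%N.
Proof.
elim: k => [|k IH]; first by rewrite /moran_count big_geq.
by rewrite moran_countS muln_gt0 IH (leq_trans _ (n_ge2 (ltn0Sn k))).
Qed.

Lemma c_lt_half k : (1 <= k)%N -> 2 * c k < 1.
Proof.
move=> k1; apply: le_lt_trans (nc_lt1 k1).
by rewrite ler_pM2r ?c_gt0 // ler_nat n_ge2.
Qed.

Lemma moran_len_le_pow2 k : moran_len k <= 2 ^- k.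
Proof.
elim: k => [|k IH]; first by rewrite /moran_len big_geq // invr1.
rewrite moran_lenS exprS invfM; apply: ler_pM => //.
- by rewrite ltW ?c_gt0.
- by rewrite ltW ?moran_len_gt0.
- by have := c_lt_half (ltn0Sn k); lra.
Qed.

Lemma moran_count_len_le1 k : (moran_count k)%:R * moran_len k <= 1.
Proof.
elim: k => [|k IH]; first by rewrite /moran_len /moran_count !big_geq // mul1r.
rewrite moran_lenS moran_countS natrM.
have := nc_lt1 (ltn0Sn k); have := c_gt0 (ltn0Sn k); have := moran_len_gt0 k.
move: IH; set N := _%:R; set m := _%:R; set d := moran_len k => Nd d0 c0 nc.
have -> : N * m * (c k.+1 * d) = (N * d) * (m * c k.+1) by ring.
by apply: mulr_ile1; rewrite ?mulr_ge0 ?ler0n // ltW.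
Qed.

Lemma word_size k s : word n k s -> size s = k.
Proof. by case. Qed.

Lemma word_rcons k s i : word n k s -> (1 <= i <= n k.+1)%N ->
  word n k.+1 (rcons s i).
Proof.
move=> [sk ws] i1; split; first by rewrite size_rcons sk.
move=> j; rewrite ltnS leq_eqVlt => /predU1P[->|jk].
  by rewrite nth_rcons sk ltnn eqxx.
by rewrite nth_rcons sk jk ws.
Qed.

Lemma word_belast k s : word n k.+1 s ->
  exists s' i, [/\ s = rcons s' i, word n k s' & (1 <= i <= n k.+1)%N].
Proof.
case/lastP: s => [[]//|s i [/eqP]]; rewrite size_rcons eqSS => /eqP sk ws.
exists s, i; split=> //; last first.
  by have := ws _ (ltnSn k); rewrite nth_rcons sk ltnn eqxx.
split=> // j jk; have := ws j (leqW jk).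
by rewrite nth_rcons sk jk.
Qed.

Lemma moran_itv_len k s : word n k s -> hi I s - lo I s = moran_len k.
Proof.
elim: k s => [|k IH] s.
  by move=> [/size0nil -> _]; have [-> ->] := moran_root I;
    rewrite subr0 /moran_len big_geq.
move=> /word_belast[s' [i [-> ws i1]]].
have := moran_ratio I ws i1; rewrite (IH _ ws) moran_lenS => <-.
by rewrite divfK // gt_eqF // moran_len_gt0.
Qed.

Lemma moran_lo_lt_hi k s : word n k s -> lo I s < hi I s.
Proof. by move=> /moran_itv_len; have := moran_len_gt0 k; lra. Qed.

Section children.
Context (k : nat) (s : seq nat) (ws : word n k s).

Let m := n k.+1.

Lemma child_sub i : (1 <= i <= m)%N ->
  lo I s <= lo I (rcons s i) /\ hi I (rcons s i) <= hi I s.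
Proof.
move=> i1; have h := ltW (moran_lo_lt_hi (word_rcons ws i1)).
have sub := moran_sub ws i1.
have : `[lo I s, hi I s]%classic (lo I (rcons s i)).
  by apply: sub; rewrite /= in_itv /= lexx.
have : `[lo I s, hi I s]%classic (hi I (rcons s i)).
  by apply: sub; rewrite /= in_itv /= lexx h.
by rewrite /= !in_itv /= => /andP[_ ->] /andP[-> _].
Qed.

Lemma child_pt_lo j : (j <= m)%N -> child_pt s j = lo I (rcons s j).
Proof. by move=> jm; rewrite /child_pt (word_size ws) jm. Qed.

Lemma child_pt_last : child_pt s m.+1 = hi I (rcons s m).
Proof. by rewrite /child_pt (word_size ws) ltnn. Qed.

Lemma child_len j : (1 <= j <= m)%N ->
  hi I (rcons s j) = child_pt s j + moran_len k.+1.
Proof.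
move=> j1; rewrite child_pt_lo; last by case/andP: j1.
by rewrite -(moran_itv_len (word_rcons ws j1)) addrCA subrr addr0.
Qed.

Lemma child_hi_le j : (1 <= j <= m)%N -> hi I (rcons s j) <= child_pt s j.+1.
Proof.
move=> /andP[j1]; rewrite leq_eqVlt => /predU1P[->|jm].
  by rewrite child_pt_last.
rewrite child_pt_lo //; apply: moran_ordered ws _.
by rewrite j1 -ltnS prednK // (leq_ltn_trans _ jm).
Qed.

(** Each step from one left endpoint to the next passes a child and a gap. It serves with [a = 0]
    and with the smallest gap. *)
Lemma child_pt_spread (a : R) i j : 0 <= a ->
  (forall l, (1 <= l < m)%N -> a <= child_pt s l.+1 - hi I (rcons s l)) ->
  (1 <= i)%N -> (i <= j <= m)%N ->
  child_pt s i + (j - i)%:R * (moran_len k.+1 + a) <= child_pt s j.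
Proof.
move=> a0 ha i1; elim: j => [|j IH] /andP[ij jm].
  by move: ij; rewrite leqn0 => /eqP i0; rewrite i0 in i1.
move: ij; rewrite leq_eqVlt => /predU1P[->|ij]; first by rewrite subnn mul0r addr0.
have jm' : (1 <= j < m)%N by rewrite (leq_trans i1).
have := ha _ jm'; rewrite child_len; last by case/andP: jm' => -> /ltnW.
have := IH; rewrite -ltnS ij /= => /(_ (ltnW jm)).
by rewrite subSn // -natr1; lra.
Qed.

Lemma child_pt_spread0 i j : (1 <= i)%N -> (i <= j <= m.+1)%N ->
  child_pt s i + (j - i)%:R * moran_len k.+1 <= child_pt s j.
Proof.
move=> i1 /andP[ij]; have m0 : (0 < m)%N by rewrite (leq_trans _ (n_ge2 (ltn0Sn k))).
have spread j' : (i <= j' <= m)%N ->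
    child_pt s i + (j' - i)%:R * moran_len k.+1 <= child_pt s j'.
  rewrite -[moran_len k.+1]addr0; apply: child_pt_spread => // l /andP[l1 lm].
  by rewrite subr_ge0 child_hi_le // l1 ltnW.
rewrite leq_eqVlt => /predU1P[jE|jm]; last by apply: spread; rewrite ij.
move: ij; rewrite leq_eqVlt => /predU1P[->|ij]; first by rewrite subnn mul0r addr0.
rewrite jE child_pt_last child_len ?m0 ?leqnn //.
have im : (i <= m)%N by rewrite -ltnS -jE.
have := spread m; rewrite im leqnn subSn // -natr1 => /(_ isT); lra.
Qed.

Lemma child_pt_lt i j : (1 <= i)%N -> (i < j <= m.+1)%N -> child_pt s i < child_pt s j.
Proof.
move=> i1 /andP[ij jm]; have := @child_pt_spread0 i j i1; rewrite (ltnW ij) jm => /(_ isT).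
apply: lt_le_trans; rewrite ltrDl mulr_gt0 ?moran_len_gt0 //.
by rewrite ltr0n subn_gt0.
Qed.

Lemma child_pt_le i j : (1 <= i)%N -> (i <= j <= m.+1)%N -> child_pt s i <= child_pt s j.
Proof.
move=> i1 /andP[]; rewrite leq_eqVlt => /predU1P[->//|ij jm].
by rewrite ltW // child_pt_lt // ij.
Qed.

Lemma ess_sub : lo I s <= child_pt s 1 /\ child_pt s m.+1 <= hi I s.
Proof.
have m0 : (0 < m)%N by rewrite (leq_trans _ (n_ge2 (ltn0Sn k))).
rewrite child_pt_lo // child_pt_last; split.
  by have [] := @child_sub 1%N; rewrite ?m0.
by have [] := @child_sub m; rewrite ?m0 ?leqnn.
Qed.

Lemma ess_ge : m%:R * moran_len k.+1 <= child_pt s m.+1 - child_pt s 1.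
Proof.
have := @child_pt_spread0 1 m.+1 isT; rewrite leqnn /= subSS subn0 => /(_ isT); lra.
Qed.

(** A gap fits into the room that the [m] children leave in their parent. For [j = m] the gap is 0
    by the convention on the last [child_pt]. *)
Lemma child_gap_le j : (1 <= j <= m)%N ->
  child_pt s j.+1 - hi I (rcons s j) <= moran_len k - m%:R * moran_len k.+1.
Proof.
move=> j1m; have /andP[j1 jm] := j1m.
rewrite child_len //.
have := @child_pt_spread0 1 j isT; rewrite j1 (leqW jm) => /(_ isT).
have := @child_pt_spread0 j.+1 m.+1 isT; rewrite ltnS jm leqnn subSS => /(_ isT).
have [] := ess_sub; have := moran_itv_len ws.
by rewrite natrB // natrB //; lra.
Qed.

Lemma min_gap_le (a : R) : 0 <= a ->
  (forall l, (1 <= l < m)%N -> a <= child_pt s l.+1 - hi I (rcons s l)) ->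
  (m.-1)%:R * a <= moran_len k - m%:R * moran_len k.+1.
Proof.
move=> a0 ha; have m0 : (0 < m)%N by rewrite (leq_trans _ (n_ge2 (ltn0Sn k))).
have := @child_pt_spread a 1 m a0 ha isT; rewrite m0 leqnn subn1 => /(_ isT).
have [] := ess_sub; rewrite child_pt_last child_len ?m0 ?leqnn //.
have := moran_itv_len ws.
have : m%:R = m.-1%:R + 1 :> R by rewrite natr1 prednK.
by move=> ->; lra.
Qed.

End children.
End moran_geometry.

(** * Covers by convex hulls of cylinder sets *)

Section moran_covers.
Context (R : realType) (n : nat -> nat) (c : nat -> R).
Context (n_ge2 : forall k, (1 <= k)%N -> (2 <= n k)%N).
Context (c_gt0 : forall k, (1 <= k)%N -> 0 < c k).
Context (nc_lt1 : forall k, (1 <= k)%N -> (n k)%:R * c k < 1).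
Context (I : moran_family n c) (ess : nat -> R).
Context (essE : forall k s, word n k s ->
  child_pt I s (n k.+1).+1 - child_pt I s 1 = ess k).

(** The words are listed so that the hulls form a finite cover indexed by position. *)
Fixpoint words k : seq (seq nat) :=
  if k is k'.+1 then [seq rcons s i | s <- words k', i <- iota 1 (n k)]
  else [:: [::]].

Lemma size_words k : size (words k) = moran_count n k.
Proof.
elim: k => [|k IH]; first by rewrite /moran_count big_geq.
by rewrite moran_countS size_allpairs IH size_iota.
Qed.

Lemma mem_words k s : s \in words k <-> word n k s.
Proof.
elim: k s => [|k IH] s /=.
  by rewrite inE; split=> [/eqP ->|[/size0nil ->]].
split=> [/allpairsP[[s' i] /= [/IH ws + ->]]|/word_belast[s' [i [-> ws i1]]]].
  by rewrite mem_iota add1n ltnS; apply: word_rcons.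
by apply/allpairsP; exists (s', i); split=> //=; [apply/IH|rewrite mem_iota add1n ltnS].
Qed.

Lemma exists_word k : exists s, word n k s.
Proof.
have : (0 < size (words k))%N by rewrite size_words (moran_count_gt0 n_ge2).
by case: (words k) (@mem_words k) => // s l /(_ s); rewrite mem_head => -[? _] _; exists s; auto.
Qed.

Lemma ess_ge_count k : (n k.+1)%:R * moran_len c k.+1 <= ess k.
Proof. by have [s ws] := exists_word k; rewrite -(essE ws); apply: ess_ge. Qed.

Lemma ess_gt0 k : 0 < ess k.
Proof.
apply: lt_le_trans (ess_ge_count k); rewrite mulr_gt0 ?(moran_len_gt0 c_gt0) //.
by rewrite ltr0n (leq_trans _ (n_ge2 (ltn0Sn k))).
Qed.

Lemma ess_le_len k : ess k <= moran_len c k.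
Proof.
have [s ws] := exists_word k; rewrite -(essE ws).
have [] := ess_sub n_ge2 c_gt0 I ws; have := moran_itv_len c_gt0 I ws; lra.
Qed.

Lemma moran_set_cover k : moran_set I `<=`
  \bigcup_(i in `I_(moran_count n k))
    [set` `[child_pt I (nth [::] (words k) i) 1,
            child_pt I (nth [::] (words k) i) (n k.+1).+1]].
Proof.
move=> x /(_ k.+1 Logic.I)[_ /word_belast[s [i [-> ws /andP[i1 im]]]]].
rewrite /moran_itv /= in_itv /= => /andP[lx xh].
have sk : s \in words k by apply/mem_words.
exists (index s (words k)); first by rewrite /= -size_words index_mem.
rewrite nth_index //= in_itv /=; apply/andP; split.
  apply: le_trans lx; rewrite -(child_pt_lo I ws im).
  by apply: (child_pt_le n_ge2 c_gt0 I ws) => //; rewrite i1 leqW.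
apply: le_trans xh _.
apply: le_trans (child_hi_le I ws _) _; first by rewrite i1.
by apply: (child_pt_le n_ge2 c_gt0 I ws) => //; rewrite ltnS im leqnn.
Qed.

Lemma moran_premeasure_le k (t d : R) : 0 < t -> ess k <= d ->
  (hausdorff_premeasure t d (moran_set I) <=
   ((moran_count n k)%:R * ess k `^ t)%:E)%E.
Proof.
move=> t0 kd; apply: hausdorff_premeasure_le_finite (moran_set_cover k) _ => //.
  by rewrite ltW ?ess_gt0.
move=> i ik; have ws : word n k (nth [::] (words k) i).
  by apply/mem_words; rewrite mem_nth // size_words.
rewrite -(essE ws); apply: diam_le_itv => //.
by rewrite -subr_ge0 (essE ws) ltW ?ess_gt0.
Qed.

(** Below the dimension some premeasure is positive, and the cover by level-[k] hulls bounds it from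
    above as soon as the hulls are short enough. The finitely many earlier levels only lower the
    constant. *)
Lemma count_ess_bounded_below (t : R) : 0 < t ->
  (t%:E < hausdorff_dim (moran_set I))%E ->
  exists2 C : R, 0 < C & forall k, C <= (moran_count n k)%:R * ess k `^ t.
Proof.
move=> t0 /(hausdorff_dim_lt (ltW t0))[d d0 Hd].
have [k0 hk0] := @expr_unbounded R 1 d^-1 ltr01.
have small k : (k0 <= k)%N -> ess k <= d.
  move=> k0k; apply: le_trans (ess_le_len k) _.
  apply: le_trans (moran_len_le_pow2 n_ge2 c_gt0 nc_lt1 k) _.
  rewrite -[d]invrK lef_pV2 ?posrE ?exprn_gt0 ?invr_gt0 //.
  by apply: le_trans hk0 _; rewrite (_ : 1 + 1 = 2) ?ler_eXn2l ?ltr1n.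
have a0 k : 0 < (moran_count n k)%:R * ess k `^ t.
  by rewrite mulr_gt0 ?powR_gt0 ?ess_gt0 // ltr0n (moran_count_gt0 n_ge2).
have Hfin : hausdorff_premeasure t d (moran_set I) \is a fin_num.
  rewrite ge0_fin_numE ?hausdorff_premeasure_ge0 //.
  by apply: le_lt_trans (moran_premeasure_le t0 (small k0 (leqnn _))) _; rewrite ltry.
apply: (@uniform_lower_bound _ _ k0 (fine (hausdorff_premeasure t d (moran_set I)))).
- exact: a0.
- by apply: fine_gt0; rewrite Hd /= -ge0_fin_numE // ltW.
- by move=> k k0k; rewrite -lee_fin fineK //; apply: moran_premeasure_le => //; apply: small.
Qed.

End moran_covers.

(** * One-step distortion under (A) or (B) *)

Section moran_weights.
Context (R : realType) (n : nat -> nat) (c : nat -> R).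
Context (n_ge2 : forall k, (1 <= k)%N -> (2 <= n k)%N).
Context (c_gt0 : forall k, (1 <= k)%N -> 0 < c k).
Context (nc_lt1 : forall k, (1 <= k)%N -> (n k)%:R * c k < 1).
Context (I : moran_family n c).

(** The reciprocal of the proportion of a parent that its children fill. Powers of it are affordable
    losses, since their product over the levels is controlled by [dim E = 1]. *)
Let inv_nc k : R := ((n k)%:R * c k)^-1.

Let inv_nc_ge1 k : 1 <= inv_nc k.+1.
Proof.
rewrite /inv_nc invf_ge1; first by rewrite ltW ?nc_lt1.
by rewrite mulr_gt0 ?c_gt0 // ltr0n (leq_trans _ (n_ge2 (ltn0Sn k))).
Qed.

Let c_powN_ge1 (e : R) k : 0 <= e -> 1 <= c k.+1 `^ (- e).
Proof.
move=> e0; rewrite powRN invf_ge1 ?powR_gt0 ?c_gt0 //.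
rewrite -(powRr0 (c k.+1)); apply: ger_powR => //; rewrite c_gt0 //=.
by have := c_lt_half n_ge2 c_gt0 nc_lt1 (ltn0Sn k); have := c_gt0 (ltn0Sn k); lra.
Qed.

Let inner_gap_gapE k s j : word n k s -> (1 <= j < n k.+1)%N ->
  inner_gaps I k.+1 (child_pt I s j.+1 - hi I (rcons s j)).
Proof.
move=> ws /andP[j1 jn]; exists s, j; split=> //.
  by rewrite j1 -ltnS prednK // (leq_ltn_trans _ jn).
rewrite /gap (word_size ws) (gtn_eqF j1) (ltn_eqF jn).
by rewrite (child_pt_lo I ws jn).
Qed.

(** Boundedness is what turns [sup] and [inf] in [alpha_max] and [alpha_min] into genuine bounds. *)
Let inner_gaps_bounds k x : inner_gaps I k.+1 x -> 0 <= x <= moran_len c k.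
Proof.
move=> [s [j [ws /andP[j1 jn] ->]]].
have nk0 : (0 < n k.+1)%N by rewrite (leq_trans _ (n_ge2 (ltn0Sn k))).
have jn' : (j < n k.+1)%N by rewrite -ltnS prednK in jn.
rewrite /gap (word_size ws) (gtn_eqF j1) (ltn_eqF jn').
rewrite -(child_pt_lo I ws jn').
have j1n : (1 <= j <= n k.+1)%N by rewrite j1 ltnW.
rewrite subr_ge0 (child_hi_le I ws j1n) /=.
apply: le_trans (child_gap_le n_ge2 c_gt0 I ws j1n) _.
by rewrite gerBl mulr_ge0 // ltW // moran_len_gt0.
Qed.

Let le_alpha_max k s j : word n k s -> (1 <= j < n k.+1)%N ->
  child_pt I s j.+1 - hi I (rcons s j) <= alpha_max I k.+1.
Proof.
move=> ws jn; apply: ub_le_sup; last exact: inner_gap_gapE.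
by exists (moran_len c k) => x /inner_gaps_bounds/andP[].
Qed.

Let alpha_min_le k s j : word n k s -> (1 <= j < n k.+1)%N ->
  alpha_min I k.+1 <= child_pt I s j.+1 - hi I (rcons s j).
Proof.
move=> ws jn; apply: ge_inf; last exact: inner_gap_gapE.
by exists 0 => x /inner_gaps_bounds/andP[].
Qed.

Let alpha_min_ge0 k s : word n k s -> 0 <= alpha_min I k.+1.
Proof.
move=> ws; apply: lb_le_inf; last by move=> x /inner_gaps_bounds/andP[].
have jn : (1 <= 1 < n k.+1)%N by rewrite n_ge2.
by eexists; apply: (inner_gap_gapE ws jn).
Qed.

Let slot_ratioE k s j : word n k s -> (1 <= j <= n k.+1)%N ->
  (child_pt I s j.+1 - child_pt I s j) / moran_len c k.+1 =
  1 + (child_pt I s j.+1 - hi I (rcons s j)) / moran_len c k.+1.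
Proof.
move=> ws jn; rewrite (child_len c_gt0 I ws jn).
by have := moran_len_gt0 c_gt0 k.+1; move=> d0; field; rewrite gt_eqF.
Qed.

(** A slot is a child with the gap on its right. Under (A) a gap is at most [w1] times the smallest
    one, which is at most [2 * (y - 1)] children because [m <= 2 * (m - 1)]. Bernoulli bounds
    [1 + 2 * w1 * (y - 1)] by a power of [y]. *)
Lemma slot_ratio_comparable (w1 : R) : 0 < w1 ->
  (forall k, (1 <= k)%N -> alpha_max I k <= w1 * alpha_min I k) ->
  exists W : nat, forall k s j, word n k s -> (1 <= j <= n k.+1)%N ->
    (child_pt I s j.+1 - child_pt I s j) / moran_len c k.+1 <= inv_nc k.+1 ^+ W.
Proof.
move=> w0 A; exists (Num.bound (2 * w1)) => k s j ws /andP[j1 jn].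
have d0 := moran_len_gt0 c_gt0 k.+1.
rewrite (slot_ratioE ws) ?j1 //.
have := inv_nc_ge1 k; set y := inv_nc k.+1 => y1.
(* The last slot is the last child alone, so its ratio is 1. *)
move: jn; rewrite leq_eqVlt => /predU1P[->|jn].
  by rewrite (child_pt_last I ws) subrr mul0r addr0 exprn_ege1.
have jn' : (1 <= j < n k.+1)%N by rewrite j1.
have y10 : 0 <= y - 1 by lra.
have := bernoulli_ge (Num.bound (2 * w1)) y10.
rewrite [X in _ <= X ^+ _](_ : _ = y); last by ring.
apply: le_trans; rewrite lerD2l.
apply: (@le_trans _ _ (2 * w1 * (y - 1))); last first.
  by rewrite ler_wpM2r // ltW // archi_boundP //; lra.
rewrite ler_pdivrMr //.
have := le_trans (le_alpha_max ws jn') (A _ (ltn0Sn k)); move/le_trans; apply.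
rewrite [2 * w1]mulrC -!mulrA ler_pM2l //.
have := min_gap_le n_ge2 c_gt0 ws (alpha_min_ge0 ws) (fun l => alpha_min_le ws).
have -> : moran_len c k - (n k.+1)%:R * moran_len c k.+1 =
    (n k.+1)%:R * ((y - 1) * moran_len c k.+1).
  rewrite /y /inv_nc moran_lenS; field.
  by rewrite !gt_eqF ?c_gt0 // ltr0n (leq_trans _ (n_ge2 (ltn0Sn k))).
have m2 := n_ge2 (ltn0Sn k).
have : (n k.+1)%:R <= 2 * (n k.+1).-1%:R :> R.
  by rewrite -natrM ler_nat; lia.
have : 1 <= (n k.+1).-1%:R :> R by rewrite ler1n; lia.
have : 0 <= (y - 1) * moran_len c k.+1 by rewrite mulr_ge0 // ltW.
move: (alpha_min I k.+1) (n k.+1).-1%:R (n k.+1)%:R ((y - 1) * moran_len c k.+1).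
move=> a p m u u0 p1 mp ap.
rewrite -(ler_pM2l (_ : 0 < p)); last by lra.
by apply: le_trans ap _; nra.
Qed.

(** Under (B) the ratio is at most [1 + w2]. If there are at least [N0] children, then [1 / c > N0]
    and [c^(-e)] absorbs this constant to the power [K]. With fewer children a gap is at most
    [N0 * (y - 1)] children, and Bernoulli yields a power of [y]. *)
Lemma slot_ratio_bounded (w2 : R) (K : nat) (e : R) : 0 < w2 -> 0 < e ->
  (forall k, (1 <= k)%N -> alpha_max I k <= w2 * moran_len c k) ->
  exists W : nat, forall k s j, word n k s -> (1 <= j <= n k.+1)%N ->
    ((child_pt I s j.+1 - child_pt I s j) / moran_len c k.+1) ^+ K <=
    c k.+1 `^ (- e) * inv_nc k.+1 ^+ W.
Proof.
move=> w0 e0 B; pose Z := (1 + w2) ^+ K.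
have Z0 : 0 <= Z by rewrite exprn_ge0 //; lra.
pose N0 := Num.bound (Z `^ e^-1).
exists (N0 * K)%N => k s j ws /andP[j1 jn].
have d0 := moran_len_gt0 c_gt0 k.+1.
have m0 : (0 < n k.+1)%N by rewrite (leq_trans _ (n_ge2 (ltn0Sn k))).
have j1n : (1 <= j <= n k.+1)%N by rewrite j1.
have gap0 := child_hi_le I ws j1n; rewrite -subr_ge0 in gap0.
rewrite (slot_ratioE ws) //.
have y1 := inv_nc_ge1 k; set y := inv_nc k.+1 in y1 *.
have ce1 := c_powN_ge1 k (ltW e0).
have r0 : 0 <= (child_pt I s j.+1 - hi I (rcons s j)) / moran_len c k.+1.
  by rewrite divr_ge0 // ltW.
have [nN|Nn] := ltnP (n k.+1) N0.
  apply: (@le_trans _ _ (y ^+ (N0 * K))); last first.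
    by rewrite ler_peMl // exprn_ge0 //; lra.
  rewrite exprM; apply: lerXn2r; rewrite ?nnegrE ?exprn_ge0 ?addr_ge0 //; first lra.
  have y10 : 0 <= y - 1 by lra.
  have := bernoulli_ge N0 y10.
  rewrite [X in _ <= X ^+ _](_ : _ = y); last by ring.
  apply: le_trans; rewrite lerD2l ler_pdivrMr //.
  apply: le_trans (child_gap_le n_ge2 c_gt0 I ws j1n) _.
  have -> : moran_len c k - (n k.+1)%:R * moran_len c k.+1 =
      (n k.+1)%:R * (y - 1) * moran_len c k.+1.
    rewrite /y /inv_nc moran_lenS; field.
    by rewrite !gt_eqF ?c_gt0 // ltr0n.
  by rewrite ler_pM2r // ler_wpM2r // ler_nat ltnW.
apply: (@le_trans _ _ (c k.+1 `^ (- e))); last first.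
  by rewrite ler_peMr ?powR_ge0 // exprn_ege1.
apply: (@le_trans _ _ Z).
  apply: lerXn2r; rewrite ?nnegrE ?addr_ge0 //; first lra.
  rewrite lerD2l ler_pdivrMr //.
  move: jn; rewrite leq_eqVlt => /predU1P[->|jn].
    by rewrite (child_pt_last I ws) subrr mulr_ge0 // ltW.
  apply: le_trans (B _ (ltn0Sn k)); apply: le_alpha_max ws _.
  by rewrite j1.
have -> : Z = (Z `^ e^-1) `^ e by rewrite -powRrM mulVf ?gt_eqF // powRr1.
have -> : c k.+1 `^ (- e) = (c k.+1)^-1 `^ e.
  by rewrite -powR_inv1 ?(ltW (c_gt0 _)) // -powRrM mulN1r.
apply: ge0_ler_powR; rewrite ?nnegrE ?powR_ge0 ?invr_ge0 ?(ltW (c_gt0 _)) ?(ltW e0) //.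
apply: le_trans (ltW (archi_boundP (powR_ge0 _ _))) _.
apply: (@le_trans _ _ (n k.+1)%:R); first by rewrite ler_nat.
by rewrite -[_^-1]mul1r ler_pdivlMr ?c_gt0 // ltW // nc_lt1.
Qed.

Context (AB : (exists2 w1 : R, 0 < w1 &
           forall k, (1 <= k)%N -> alpha_max I k <= w1 * alpha_min I k) \/
        (exists2 w2 : R, 0 < w2 &
           forall k, (1 <= k)%N -> alpha_max I k <= w2 * moran_len c k)).

Lemma slot_ratio_bound (K : nat) (e : R) : 0 < e ->
  exists W : nat, forall k s j, word n k s -> (1 <= j <= n k.+1)%N ->
    ((child_pt I s j.+1 - child_pt I s j) / moran_len c k.+1) ^+ K <=
    c k.+1 `^ (- e) * inv_nc k.+1 ^+ W.
Proof.
move=> e0; case: AB => -[w w0 hw]; last exact: slot_ratio_bounded hw.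
have [W hW] := slot_ratio_comparable w0 hw.
exists (W * K)%N => k s j ws jn.
have y0 : 0 <= inv_nc k.+1 by apply: le_trans (inv_nc_ge1 k).
apply: (@le_trans _ _ (inv_nc k.+1 ^+ (W * K))); last first.
  by rewrite ler_peMl ?c_powN_ge1 ?exprn_ge0 // ltW.
rewrite exprM; apply: lerXn2r; rewrite ?nnegrE ?exprn_ge0 ?hW //.
rewrite divr_ge0 ?(ltW (moran_len_gt0 c_gt0 _)) // subr_ge0.
case/andP: jn => j1 jn.
by apply: child_pt_le n_ge2 c_gt0 I _ _ ws _ _ _ _ => //; rewrite leqnSn.
Qed.

End moran_weights.

(** * The mass distribution on the image *)

Section moran_image_weights.
Context (R : realType) (n : nat -> nat) (c : nat -> R).
Context (n_ge2 : forall k, (1 <= k)%N -> (2 <= n k)%N).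
Context (c_gt0 : forall k, (1 <= k)%N -> 0 < c k).
Context (nc_lt1 : forall k, (1 <= k)%N -> (n k)%:R * c k < 1).
Context (I : moran_family n c).
Context (AB : (exists2 w1 : R, 0 < w1 &
           forall k, (1 <= k)%N -> alpha_max I k <= w1 * alpha_min I k) \/
        (exists2 w2 : R, 0 < w2 &
           forall k, (1 <= k)%N -> alpha_max I k <= w2 * moran_len c k)).
Context (ess : nat -> R).
Context (essE : forall k s, word n k s ->
  child_pt I s (n k.+1).+1 - child_pt I s 1 = ess k).
Context (g : R -> R) (M : R) (gq : line_qs M g).

Let gi x y : x < y -> g x < g y. Proof. by case: gq => _ + _; apply. Qed.

Let n_gt0 k : (0 < n k.+1)%N. Proof. exact: leq_trans (n_ge2 (ltn0Sn k)). Qed.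

Definition ess_img (s : seq nat) : R :=
  g (child_pt I s (n (size s).+1).+1) - g (child_pt I s 1).

(** The affine copy, from [A] to [B], of the [g]-images of the points [child_pt I s j]. *)
Definition cut (s : seq nat) (A B : R) (j : nat) : R :=
  A + (B - A) * ((g (child_pt I s j) - g (child_pt I s 1)) / ess_img s).

(* [weighted k s A B] : the interval `[A, B[ is what the mass distribution on
   the image set assigns to the word [s] of length [k]. A child receives mass in
   proportion to the image of its own interval and of the gap on its right, so
   that the partial sums telescope. *)
Inductive weighted : nat -> seq nat -> R -> R -> Prop :=
| Weighted0 : weighted 0 [::] 0 1
| WeightedS k s A B j : weighted k s A B -> (1 <= j <= n k.+1)%N ->
    weighted k.+1 (rcons s j) (cut s A B j) (cut s A B j.+1).

Lemma ess_imgE k s : word n k s ->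
  ess_img s = g (child_pt I s (n k.+1).+1) - g (child_pt I s 1).
Proof. by move=> ws; rewrite /ess_img (word_size ws). Qed.

Lemma ess_img_gt0 k s : word n k s -> 0 < ess_img s.
Proof.
move=> ws; rewrite /ess_img (word_size ws) subr_gt0; apply: gi.
by apply: (child_pt_lt n_ge2 c_gt0 I ws) => //; rewrite leqnn ltnS n_gt0.
Qed.

Lemma cut_first s A B : cut s A B 1 = A.
Proof. by rewrite /cut subrr mul0r mulr0 addr0. Qed.

Lemma cut_last k s A B : word n k s -> cut s A B (n k.+1).+1 = B.
Proof.
move=> ws; have := ess_img_gt0 ws; rewrite /cut -(word_size ws) => e0.
by rewrite divff ?gt_eqF // mulr1 addrCA subrr addr0.
Qed.

Lemma cutB s A B i j : cut s A B j - cut s A B i =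
  (B - A) * ((g (child_pt I s j) - g (child_pt I s i)) / ess_img s).
Proof. by rewrite /cut; ring. Qed.

Lemma weighted_word k s A B : weighted k s A B -> word n k s /\ A < B.
Proof.
elim=> {k s A B} [|k s A B j _ [ws AB0] /andP[j1 jn]]; first by split=> //; exact: ltr01.
split; first by apply: word_rcons; rewrite ?j1.
rewrite -subr_gt0 cutB mulr_gt0 ?subr_gt0 // divr_gt0 ?(ess_img_gt0 ws) //.
rewrite subr_gt0; apply: gi.
by apply: (child_pt_lt n_ge2 c_gt0 I ws) => //; rewrite ltnSn ltnS.
Qed.

(** The one-step factor. It has two sources, both handled by [line_qs_stretch]: passing from the
    hull to the whole interval, and from the child to its slot. *)
Lemma image_loss (e : R) : 0 < e -> exists K : nat, forall k s j,
  word n k s -> (1 <= j <= n k.+1)%N ->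
  (g (hi I s) - g (lo I s)) * (g (child_pt I s j.+1) - g (child_pt I s j)) <=
  c k.+1 `^ (- e) * (((n k.+1)%:R * c k.+1)^-1) ^+ K *
  (ess_img s * (g (hi I (rcons s j)) - g (lo I (rcons s j)))).
Proof.
move=> e0; have M0 : 0 < M by case: gq.
pose e2 := e / 2; have e20 : 0 < e2 by rewrite divr_gt0.
(* Each stretch costs [1 + z]. Since [(1 + z)^2 <= 1 + 3 * z <= 2^e2] and [c < 1/2], both together
   fit into one factor [c^(-e2)]. *)
pose z := Num.min 1 ((2 `^ e2 - 1) / 3).
have two1 : 1 < 2 `^ e2 :> R.
  rewrite /powR pnatr_eq0 /= -[X in X < _]expR0 ltr_expR mulr_gt0 //.
  by rewrite ln_gt0 //; lra.
have z0 : 0 < z by rewrite lt_min ltr01 divr_gt0 ?subr_gt0.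
have z2 : (1 + z) * (1 + z) <= 2 `^ e2.
  have : z <= 1 by rewrite ge_min lexx.
  have : z <= (2 `^ e2 - 1) / 3 by rewrite ge_min lexx orbT.
  by nra.
have [K hK] := line_qs_stretch M0 z0.
have [W hW] := slot_ratio_bound n_ge2 c_gt0 nc_lt1 AB K e20.
exists (K + W)%N => k s j ws jn; have /andP[j1 jn'] := jn.
set y := ((n k.+1)%:R * c k.+1)^-1.
have d0 := moran_len_gt0 c_gt0 k; have d1 := moran_len_gt0 c_gt0 k.+1.
have n0 : 0 < (n k.+1)%:R :> R by rewrite ltr0n (leq_trans _ (n_ge2 (ltn0Sn k))).
have [sub1 sub2] := ess_sub n_ge2 c_gt0 I ws.
have ess0 : child_pt I s 1 < child_pt I s (n k.+1).+1.
  by apply: (child_pt_lt n_ge2 c_gt0 I ws) => //; rewrite leqnn ltnS n_gt0.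
have ws' := word_rcons ws jn.
have h1 : g (hi I s) - g (lo I s) <= (1 + z) * y ^+ K * ess_img s.
  have EI : ess_img s = g (child_pt I s (n k.+1).+1) - g (child_pt I s 1).
    by rewrite /ess_img (word_size ws).
  rewrite EI; apply: le_trans (hK g _ _ _ _ gq sub1 ess0 sub2) _; rewrite -EI.
  rewrite ler_pM2r ?(ess_img_gt0 ws) // ler_pM2l ?addr_gt0 //.
  rewrite (moran_itv_len c_gt0 I ws).
  have := ess_ge n_ge2 c_gt0 I ws; rewrite moran_lenS => ge.
  have ess0' : 0 < child_pt I s (n k.+1).+1 - child_pt I s 1 by rewrite subr_gt0.
  apply: lerXn2r; rewrite ?nnegrE /y ?(word_size ws) ?invr_ge0 ?divr_ge0 ?mulr_ge0 ?(ltW n0) ?(ltW d0) ?(ltW (c_gt0 _)) ?(ltW ess0') //.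
  rewrite ler_pdivrMr // mulrC ler_pdivlMr ?mulr_gt0 ?c_gt0 //.
  by move: ge; rewrite mulrA mulrC.
have lt := moran_lo_lt_hi c_gt0 I ws'.
have h2 : g (child_pt I s j.+1) - g (child_pt I s j) <=
    (1 + z) * (c k.+1 `^ (- e2) * y ^+ W) * (g (hi I (rcons s j)) - g (lo I (rcons s j))).
  rewrite (child_pt_lo I ws jn').
  have := hK g _ _ _ _ gq (lexx _) lt (child_hi_le I ws jn).
  move/le_trans; apply.
  rewrite ler_pM2r ?subr_gt0 ?gi // ler_pM2l ?addr_gt0 //.
  rewrite (moran_itv_len c_gt0 I ws') -(child_pt_lo I ws jn').
  exact: hW.
have c2 : 2 `^ e2 <= c k.+1 `^ (- e2).
  rewrite powRN -[2]invrK -powR_inv1 // -powRrM mulN1r powRN lef_pV2 ?posrE ?powR_gt0 ?c_gt0 //.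
  have := c_lt_half n_ge2 c_gt0 nc_lt1 (ltn0Sn k) => c2.
  apply: ge0_ler_powR; rewrite ?nnegrE ?(ltW e20) ?(ltW (c_gt0 _)) //.
  by rewrite -[_^-1]mul1r ler_pdivlMr //; lra.
have y0 : 0 <= y by rewrite invr_ge0 mulr_ge0 ?(ltW n0) ?(ltW (c_gt0 _)).
apply: (@le_trans _ _ ((1 + z) * y ^+ K * ess_img s * ((1 + z) * (c k.+1 `^ (- e2) * y ^+ W) *
    (g (hi I (rcons s j)) - g (lo I (rcons s j)))))).
  apply: ler_pM => //; rewrite subr_ge0 (line_qs_le gq) //.
    by rewrite ltW // (moran_lo_lt_hi c_gt0 I ws).
  by apply: (child_pt_le n_ge2 c_gt0 I ws); rewrite // leqnSn.
set P := ess_img s * _.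
have P0 : 0 <= P by rewrite mulr_ge0 ?(ltW (ess_img_gt0 ws)) // subr_ge0 ltW ?gi.
have ce : c k.+1 `^ (- e) = c k.+1 `^ (- e2) * c k.+1 `^ (- e2).
  by rewrite -powRD ?(gt_eqF (c_gt0 _)) ?implybT //; congr (_ `^ _); rewrite /e2; lra.
rewrite ce exprD.
have -> : (1 + z) * y ^+ K * ess_img s *
   ((1 + z) * (c k.+1 `^ (- e2) * y ^+ W) * (g (hi I (rcons s j)) - g (lo I (rcons s j)))) =
   (1 + z) * (1 + z) * (c k.+1 `^ (- e2) * (y ^+ K * y ^+ W) * P) by rewrite /P; ring.
have -> : c k.+1 `^ (- e2) * c k.+1 `^ (- e2) * (y ^+ K * y ^+ W) * P =
  c k.+1 `^ (- e2) * (c k.+1 `^ (- e2) * (y ^+ K * y ^+ W) * P) by ring.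
apply: ler_wpM2r; last exact: le_trans c2.
by apply: mulr_ge0 => //; rewrite mulr_ge0 ?powR_ge0 // mulr_ge0 // exprn_ge0.
Qed.

(** The factors of [image_loss] are multiplied along the word; [g 1 - g 0] normalises level 0. *)
Lemma weighted_le_len (e : R) : 0 < e -> exists K : nat, forall k s A B,
  weighted k s A B ->
  (B - A) * (g 1 - g 0) <=
  moran_len c k `^ (- e) * (((moran_count n k)%:R * moran_len c k)^-1) ^+ K *
  (g (hi I s) - g (lo I s)).
Proof.
move=> e0; have [K hK] := image_loss e0; exists K => k s A B.
elim=> {k s A B} [|k s A B j wt IH jn].
  have [-> ->] := moran_root I.
  rewrite /moran_len /moran_count !big_geq //.
  by rewrite powR1 subr0 !mul1r invr1 expr1n mul1r.
have [ws AB0] := weighted_word wt.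
rewrite cutB; have := hK k s j ws jn; have E0 := ess_img_gt0 ws.
have d0 := moran_len_gt0 c_gt0 k; have c0 := c_gt0 (ltn0Sn k).
rewrite moran_lenS moran_countS natrM powRM ?(ltW c0) ?(ltW d0) //.
have -> : (moran_count n k)%:R * (n k.+1)%:R * (c k.+1 * moran_len c k) =
  ((moran_count n k)%:R * moran_len c k) * ((n k.+1)%:R * c k.+1) by ring.
set a := _ * moran_len c k; set b := _ * c k.+1.
have -> : (a * b)^-1 ^+ K = a^-1 ^+ K * b^-1 ^+ K by rewrite invfM exprMn.
have a0 : 0 <= a by rewrite mulr_ge0 // ltW.
have slot0 : 0 < g (child_pt I s j.+1) - g (child_pt I s j).
  rewrite subr_gt0; apply: gi; case/andP: jn => j1 jn.
  by apply: (child_pt_lt n_ge2 c_gt0 I ws); rewrite // ltnSn.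
move: IH slot0 E0; rewrite -/a.
set P := moran_len c k `^ _; set Y := a^-1 ^+ K; set p := c k.+1 `^ _; set y := b^-1 ^+ K.
move: (g (hi I s) - g (lo I s)) (g (child_pt I s j.+1) - _) (ess_img s).
move: (g (hi I (rcons s j)) - _) (g 1 - g 0) (B - A) => S D w J T E.
move=> IH T0 E0 loss.
have -> : w * (T / E) * D = w * D * T / E by ring.
rewrite ler_pdivrMr //.
apply: (@le_trans _ _ (P * Y * J * T)).
  by rewrite ler_pM2r.
have PY : 0 <= P * Y.
  by rewrite mulr_ge0 ?powR_ge0 // exprn_ge0 // invr_ge0.
have := ler_wpM2l PY loss; rewrite !mulrA => /le_trans; apply.
by rewrite le_eqVlt; apply/orP; left; apply/eqP; ring.
Qed.

Context (dimE : hausdorff_dim (moran_set I) = 1%E).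

Lemma ess_in01 k s : word n k s -> 0 <= child_pt I s 1 /\ child_pt I s (n k.+1).+1 <= 1.
Proof.
move=> ws; have [] := ess_sub n_ge2 c_gt0 I ws.
have [] : 0 <= lo I s /\ hi I s <= 1; last by lra.
elim: k s ws => [|k IH] s.
  by case=> /size0nil -> _; have [-> ->] := moran_root I.
move=> /word_belast[s' [i [-> ws' i1]]]; have [] := IH _ ws'.
by have [] := child_sub c_gt0 I ws' i1; lra.
Qed.

(** With [x] the hull length and [G] its [g]-length, all losses together are at most a constant
    times [x^(-2e)]. Writing [G = G^(1-s) * G^s], the Hoelder bound on [G^(1-s)] gives [x^(2e)],
    which cancels them. *)
Lemma weighted_le_img (s : R) : 0 < s < 1 -> exists2 C : R, 0 < C &
  forall k w A B, weighted k w A B -> B - A <= C * ess_img w `^ s.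
Proof.
move=> /andP[s0 s1]; have M0 : 0 < M by case: gq.
have [q [C0 [q0 C00 holder]]] := line_qs_holder gq.
(* Chosen so that [x^(q * (1 - s)) = x^e * x^e]: one factor for the powers of the lengths, one for
   the powers of [D]. *)
pose e := q * (1 - s) / 2.
have e0 : 0 < e by rewrite divr_gt0 // mulr_gt0 ?subr_gt0.
have [K hK] := weighted_le_len e0.
have [K' hK'] := line_qs_stretch M0 (ltr01 : 0 < 1 :> R).
(* [D] enters to the power [K + K'], so [u * L <= e] limits its cost to [x^(-e)]; the bound
   [u <= 1/2] keeps the exponent [1 - u] positive. *)
pose L : R := (K + K').+1%:R; have L0 : 0 < L by rewrite ltr0n.
pose u := Num.min (1 / 2) (e / L).
have u0 : 0 < u by rewrite lt_min; apply/andP; split; rewrite divr_gt0.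
have u12 : u <= 1 / 2 by rewrite ge_min lexx.
have uL : u * L <= e by rewrite -ler_pdivlMr // ge_min lexx orbT.
have t0 : 0 < 1 - u by lra.
have tE : ((1 - u)%:E < hausdorff_dim (moran_set I))%E by rewrite dimE lte_fin; lra.
have [C1 C10 hC1] := count_ess_bounded_below n_ge2 c_gt0 nc_lt1 essE t0 tE.
have D0 : 0 < g 1 - g 0 by rewrite subr_gt0; apply: gi; lra.
pose C := (C1^-1 ^+ (K + K') * 2 * C0 `^ (1 - s)) / (g 1 - g 0).
have C0' : 0 < C.
  by rewrite divr_gt0 // !mulr_gt0 ?exprn_gt0 ?invr_gt0 ?powR_gt0.
exists C => // k w A B wt; have [ww AB0] := weighted_word wt.
have x0 := ess_gt0 n_ge2 c_gt0 essE k.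
have xlen := ess_le_len n_ge2 c_gt0 essE k.
have d0 := moran_len_gt0 c_gt0 k.
have d1 : moran_len c k <= 1.
  by apply: le_trans (moran_len_le_pow2 n_ge2 c_gt0 nc_lt1 k) _;
    rewrite invf_le1 ?exprn_gt0 // exprn_ege1 // ler1n.
set x := ess k in x0 xlen.
have N0 : 0 < (moran_count n k)%:R :> R by rewrite ltr0n (moran_count_gt0 n_ge2).
have G0 := ess_img_gt0 ww.
pose D := C1^-1 * x `^ (- u).
have D00 : 0 < D by rewrite mulr_gt0 ?invr_gt0 ?powR_gt0.
have xu : x = x `^ (1 - u) * x `^ u.
  by rewrite -powRD ?(gt_eqF x0) ?implybT // subrK powRr1 // ltW.
have Nx : D^-1 <= (moran_count n k)%:R * x.
  rewrite {1}xu mulrA /D invfM invrK -powRN opprK ler_pM2r ?powR_gt0 //.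
have Nd0 : 0 < (moran_count n k)%:R * moran_len c k by rewrite mulr_gt0.
have Nd : ((moran_count n k)%:R * moran_len c k)^-1 <= D.
  rewrite -[D]invrK lef_pV2 ?posrE ?invr_gt0 ?Nd0 //.
  by apply: le_trans Nx _; rewrite ler_pM2l.
(* The count times the length of a level-[k] interval is at most 1, hence length over [x] is at most
   the reciprocal of count times [x]. *)
have dx : moran_len c k / x <= D.
  rewrite ler_pdivrMr // -ler_pdivrMl // -(ler_pM2l N0) mulrCA.
  apply: le_trans Nx; rewrite ger_pMr ?invr_gt0 //.
  exact: moran_count_len_le1.
have GI : g (hi I w) - g (lo I w) <= 2 * D ^+ K' * ess_img w.
  have [sub1 sub2] := ess_sub n_ge2 c_gt0 I ww.
  have EI : ess_img w = g (child_pt I w (n k.+1).+1) - g (child_pt I w 1).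
    by rewrite /ess_img (word_size ww).
  have lt1 : child_pt I w 1 < child_pt I w (n k.+1).+1 by rewrite -subr_gt0 essE.
  rewrite EI; apply: le_trans (hK' g _ _ _ _ gq sub1 lt1 sub2) _; rewrite -EI.
  rewrite ler_pM2r // -mulr2n ler_pM2l //.
  rewrite (moran_itv_len c_gt0 I ww) essE // -/x.
  by apply: lerXn2r => //; rewrite nnegrE; [apply: divr_ge0; exact: ltW|exact: ltW].
have de : moran_len c k `^ (- e) <= x `^ (- e).
  rewrite !powRN lef_pV2 ?posrE ?powR_gt0 //.
  by apply: ge0_ler_powR; rewrite ?nnegrE // ltW.
have Hx : ess_img w <= C0 * x `^ q.
  have [p0 p1] := ess_in01 ww.
  rewrite /ess_img (word_size ww) /x -(essE ww); apply: holder => //.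
  by rewrite -subr_gt0 essE.
have step1 : (B - A) * (g 1 - g 0) <= x `^ (- e) * D ^+ K * (2 * D ^+ K' * ess_img w).
  apply: le_trans (hK _ _ _ _ wt) _; apply: ler_pM.
  - by rewrite mulr_ge0 ?powR_ge0 // exprn_ge0 // invr_ge0 mulr_ge0 // ltW.
  - by rewrite subr_ge0 (line_qs_le gq) // ltW // (moran_lo_lt_hi c_gt0 I ww).
  - have v0 : 0 <= ((moran_count n k)%:R * moran_len c k)^-1.
      by rewrite invr_ge0 mulr_ge0 // ltW.
    have D0' : 0 <= D by exact: ltW.
    apply: ler_pM de _; [exact: powR_ge0|exact: exprn_ge0|].
    by apply: lerXn2r.
  - exact: GI.
have DKK : D ^+ (K + K') <= C1^-1 ^+ (K + K') * x `^ (- e).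
  rewrite exprMn ler_pM2l ?exprn_gt0 ?invr_gt0 //.
  rewrite -powR_mulrn ?powR_ge0 // -powRrM.
  apply: ger_powR; first by rewrite x0 (le_trans xlen).
  by rewrite mulNr lerN2; apply: le_trans uL; rewrite ler_pM2l // ler_nat leqnSn.
have Gs : ess_img w = ess_img w `^ (1 - s) * ess_img w `^ s.
  by rewrite -powRD ?(gt_eqF G0) ?implybT // subrK powRr1 // ltW.
have G1s : ess_img w `^ (1 - s) <= C0 `^ (1 - s) * (x `^ e * x `^ e).
  rewrite -powRD ?(gt_eqF x0) ?implybT //.
  have -> : e + e = q * (1 - s) by rewrite /e; lra.
  rewrite powRrM -powRM ?powR_ge0 ?(ltW C00) //.
  by apply: ge0_ler_powR; rewrite ?nnegrE ?mulr_ge0 ?powR_ge0 ?(ltW C00) ?(ltW G0) //; lra.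
rewrite -(ler_pM2r D0); apply: le_trans step1 _.
have -> : C * ess_img w `^ s * (g 1 - g 0) =
    C1^-1 ^+ (K + K') * 2 * C0 `^ (1 - s) * ess_img w `^ s.
  by rewrite /C mulrAC divfK // gt_eqF.
rewrite {1}Gs.
have xe : x `^ (- e) * x `^ e = 1 by rewrite powRN mulVf // gt_eqF // powR_gt0.
have -> : x `^ (- e) * D ^+ K * (2 * D ^+ K' * (ess_img w `^ (1 - s) * ess_img w `^ s)) =
    x `^ (- e) * D ^+ (K + K') * ess_img w `^ (1 - s) * (2 * ess_img w `^ s).
  by rewrite exprD; ring.
set P := C1^-1 ^+ (K + K') in DKK *.
have P0 : 0 <= P by rewrite exprn_ge0 // invr_ge0 ltW.
apply: (@le_trans _ _ (x `^ (- e) * (P * x `^ (- e)) * (C0 `^ (1 - s) * (x `^ e * x `^ e)) *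
    (2 * ess_img w `^ s))).
  apply: ler_wpM2r; first by rewrite mulr_ge0 ?powR_ge0.
  apply: ler_pM => //; rewrite ?powR_ge0 ?mulr_ge0 ?powR_ge0 ?exprn_ge0 ?(ltW D00) //.
  by rewrite ler_pM2l ?powR_gt0.
rewrite le_eqVlt; apply/orP; left; apply/eqP.
transitivity ((x `^ (- e) * x `^ e) * (x `^ (- e) * x `^ e) *
   (P * C0 `^ (1 - s) * 2 * ess_img w `^ s)); first by ring.
by rewrite xe; ring.
Qed.

Lemma weighted_small (d : R) : 0 < d ->
  exists k0, forall k w A B, (k0 <= k)%N -> weighted k w A B -> B - A <= d.
Proof.
move=> d0; have s01 : 0 < (1 / 2 : R) < 1 by apply/andP; split; lra.
have [C C0 hC] := weighted_le_img s01.
have [q [C1 [q0 C10 holder]]] := line_qs_holder gq.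
(* Solves [C * (C1 * r^q)^(1/2) = d]; the exponent 1/2 is an arbitrary choice in []0, 1[]. *)
pose r := (((d / C) `^ 2) / C1) `^ q^-1.
have r0 : 0 < r by rewrite powR_gt0 // divr_gt0 // powR_gt0 // divr_gt0.
have [k0 hk] := @expr_unbounded R 1 r^-1 ltr01.
exists k0 => k w A B k0k wt; have [ww _] := weighted_word wt.
have x0 := ess_gt0 n_ge2 c_gt0 essE k.
have xr : ess k <= r.
  apply: le_trans (ess_le_len n_ge2 c_gt0 essE k) _.
  apply: le_trans (moran_len_le_pow2 n_ge2 c_gt0 nc_lt1 k) _.
  rewrite -[r]invrK lef_pV2 ?posrE ?exprn_gt0 ?invr_gt0 //.
  by apply: le_trans hk _; rewrite (_ : 1 + 1 = 2) ?ler_eXn2l ?ltr1n.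
have Hx : ess_img w <= C1 * ess k `^ q.
  have [p0 p1] := ess_in01 ww.
  rewrite /ess_img (word_size ww) -(essE ww); apply: holder => //.
  by rewrite -subr_gt0 essE.
apply: le_trans (hC _ _ _ _ wt) _; rewrite -ler_pdivlMl // [C^-1 * d]mulrC.
have -> : d / C = ((d / C) `^ 2) `^ (1 / 2).
  by rewrite -powRrM mul1r divff ?pnatr_eq0 // powRr1 // divr_ge0 // ltW.
apply: ge0_ler_powR; rewrite ?nnegrE ?powR_ge0 ?(ltW (ess_img_gt0 ww)) //.
apply: le_trans Hx _; rewrite mulrC -ler_pdivlMr //.
have -> : ((d / C) `^ 2) / C1 = r `^ q.
  by rewrite /r -powRrM mulVf ?gt_eqF // powRr1 // divr_ge0 ?powR_ge0 // ltW.
by apply: ge0_ler_powR; rewrite ?nnegrE ?(ltW q0) ?(ltW x0) ?(ltW r0).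
Qed.

End moran_image_weights.

(** * Points of the Moran set addressed by [0,1) *)

Lemma nat_crossing {R : realType} (a : nat -> R) (t : R) m :
  a 1%N <= t -> t < a m.+1 -> exists j, (1 <= j <= m)%N /\ a j <= t < a j.+1.
Proof.
move=> a1; elim: m => [|m IH] am; first by rewrite ltNge a1 in am.
have [/IH[j [/andP[j1 jm] h]]|le_t] := ltP t (a m.+1).
  by exists j; rewrite j1 leqW.
by exists m.+1; rewrite le_t am ltnSn.
Qed.

Section moran_address.
Context (R : realType) (n : nat -> nat) (c : nat -> R).
Context (n_ge2 : forall k, (1 <= k)%N -> (2 <= n k)%N).
Context (c_gt0 : forall k, (1 <= k)%N -> 0 < c k).
Context (I : moran_family n c) (g : R -> R) (M : R) (gq : line_qs M g).

Local Notation cut := (cut I g).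
Local Notation weighted := (weighted I g).
Local Notation ess_img := (ess_img I g).
Local Notation child_pt := (child_pt I).

(** The state holds a word and the ends of its mass interval. The default letter 1 never occurs for
    [0 <= t < 1], as [address_next] finds a crossing. *)
Definition address_step (t : R) (st : seq nat * R * R) : seq nat * R * R :=
  let: (w, A, B) := st in
  let j := xget 1%N [set j | (1 <= j <= n (size w).+1)%N /\
                             cut w A B j <= t < cut w A B j.+1] in
  (rcons w j, cut w A B j, cut w A B j.+1).

Definition address (t : R) (k : nat) := iter k (address_step t) ([::], 0, 1).

Local Notation wd t k := (address t k).1.1.
Local Notation lb t k := (address t k).1.2.
Local Notation rb t k := (address t k).2.

Lemma address_next (t : R) k : 0 <= t < 1 ->
  [/\ weighted k (wd t k) (lb t k) (rb t k), lb t k <= t < rb t k &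
    exists2 j, (1 <= j <= n k.+1)%N & address t k.+1 =
      (rcons (wd t k) j, cut (wd t k) (lb t k) (rb t k) j,
       cut (wd t k) (lb t k) (rb t k) j.+1) /\
      cut (wd t k) (lb t k) (rb t k) j <= t < cut (wd t k) (lb t k) (rb t k) j.+1].
Proof.
move=> t01.
have step k' : weighted k' (wd t k') (lb t k') (rb t k') ->
    lb t k' <= t < rb t k' ->
    exists2 j, (1 <= j <= n k'.+1)%N & address t k'.+1 =
      (rcons (wd t k') j, cut (wd t k') (lb t k') (rb t k') j,
       cut (wd t k') (lb t k') (rb t k') j.+1) /\
      cut (wd t k') (lb t k') (rb t k') j <= t < cut (wd t k') (lb t k') (rb t k') j.+1.
  rewrite /address iterS; case: (iter k' _ _) => [[w A] B] /= wt /andP[At tB].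
  have [ww AB0] := weighted_word n_ge2 c_gt0 gq wt.
  have [j hj] : exists j, (1 <= j <= n k'.+1)%N /\ cut w A B j <= t < cut w A B j.+1.
    apply: nat_crossing; first by rewrite cut_first.
    by rewrite (cut_last n_ge2 c_gt0 I gq A B ww).
  rewrite (word_size ww); set P := [set _ | _].
  have [xj xt] : P (xget 1%N P) by apply: (xgetI 1%N (_ : P j)).
  by exists (xget 1%N P).
have inv k' : weighted k' (wd t k') (lb t k') (rb t k') /\ lb t k' <= t < rb t k'.
  elim: k' => [|k' [wt tAB]]; first by split=> //; exact: Weighted0.
  have [j jn [-> ht]] := step _ wt tAB; split=> //.
  exact: WeightedS.
by have [wt tAB] := inv k; split=> //; apply: step.
Qed.

Lemma address_weighted (t : R) k : 0 <= t < 1 ->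
  weighted k (wd t k) (lb t k) (rb t k).
Proof. by move=> /(address_next k)[]. Qed.

Lemma address_word (t : R) k : 0 <= t < 1 -> word n k (wd t k).
Proof. by move=> /(address_weighted k)/(weighted_word n_ge2 c_gt0 gq)[]. Qed.

Definition address_pt (t : R) : R := sup (range (fun k => lo I (wd t k))).

Lemma address_ptP (t : R) k : 0 <= t < 1 ->
  lo I (wd t k) <= address_pt t <= hi I (wd t k).
Proof.
move=> t01.
have sub k' : lo I (wd t k') <= lo I (wd t k'.+1) /\ hi I (wd t k'.+1) <= hi I (wd t k').
  have [_ _ [j jn [-> _]]] := address_next k' t01.
  exact: (child_sub c_gt0 I (address_word k' t01) jn).
have lo_mono : {homo (fun k => lo I (wd t k)) : i j / (i <= j)%N >-> i <= j}.
  by apply: homo_leq => // [? ? ?|i]; [exact: le_trans|case: (sub i)].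
have hi_mono : {homo (fun k => hi I (wd t k)) : i j / (i <= j)%N >-> j <= i}.
  by apply: homo_leq => // [y x z xy yz|i]; [exact: le_trans yz xy|case: (sub i)].
have lohi i : lo I (wd t i) <= hi I (wd t k).
  have lh m := ltW (moran_lo_lt_hi c_gt0 I (address_word m t01)).
  have [ik|/ltnW ki] := leqP i k.
    exact: le_trans (lo_mono _ _ ik) (lh k).
  exact: le_trans (lh i) (hi_mono _ _ ki).
apply/andP; split.
  by apply: ub_le_sup; [exists (hi I (wd t k)) => _ [i _ <-]|exists k].
by apply: ge_sup; [exists (lo I (wd t k)), k|move=> _ [i _ <-]].
Qed.

Lemma address_pt_moran (t : R) : 0 <= t < 1 -> moran_set I (address_pt t).
Proof.
move=> t01 k _; exists (wd t k); first exact: address_word.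
by rewrite /moran_itv /= in_itv /=; apply: address_ptP.
Qed.

Context (s C : R) (s01 : 0 < s < 1) (C0 : 0 < C).
Context (massC : forall k w A B, weighted k w A B -> B - A <= C * ess_img w `^ s).
Context (mass0 : forall d, 0 < d -> exists k0, forall k w A B, (k0 <= k)%N -> weighted k w A B -> B - A <= d).

Let gle : {homo g : x y / x <= y}. Proof. exact: line_qs_le gq. Qed.
Let s_ge0 : 0 <= s. Proof. by case/andP: s01 => /ltW. Qed.

Let powR_homo (x y : R) : 0 <= x -> x <= y -> x `^ s <= y `^ s.
Proof. by move=> x0 xy; apply: ge0_ler_powR; rewrite ?nnegrE // (le_trans x0). Qed.

(** With [E] the [g]-length of the hull, the slice has mass at most [C * E^s * (D / E)]. As
    [D / E <= 1] and [s < 1], this is at most [C * D^s]. *)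
Lemma slice_mass k w A B D r : weighted k w A B -> 0 <= D -> D <= ess_img w ->
  D <= r -> (B - A) * (D / ess_img w) <= C * r `^ s.
Proof.
move=> wt D0 DE Dr; have [ww _] := weighted_word n_ge2 c_gt0 gq wt.
have E0 := ess_img_gt0 n_ge2 c_gt0 I gq ww.
apply: (@le_trans _ _ (C * ess_img w `^ s * (D / ess_img w))).
  by apply: ler_wpM2r; [rewrite divr_ge0 // ltW|exact: massC wt].
rewrite -mulrA ler_pM2l //; apply: le_trans (powR_homo D0 Dr).
have [->|D00] := eqVneq D 0; first by rewrite mul0r mulr0 powR_ge0.
have Dgt : 0 < D by rewrite lt_neqAle eq_sym D00.
have -> : D `^ s = ess_img w `^ s * (D / ess_img w) `^ s.
  by rewrite -powRM ?divr_ge0 ?(ltW E0) // mulrC divfK // gt_eqF.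
rewrite ler_pM2l ?powR_gt0 // ger1_powR //; last by case/andP: s01 => _ /ltW.
by rewrite divr_gt0 //= ler_pdivrMr // mul1r.
Qed.

Lemma cut_diff_le k w A B i j r : weighted k w A B -> (1 <= i)%N ->
  (i <= j <= (n k.+1).+1)%N -> g (child_pt w j) - g (child_pt w i) <= r ->
  cut w A B j - cut w A B i <= C * r `^ s.
Proof.
move=> wt i1 /andP[ij jn] Dr; have [ww _] := weighted_word n_ge2 c_gt0 gq wt.
rewrite cutB; apply: slice_mass wt _ _ Dr.
  by rewrite subr_ge0 gle // (child_pt_le n_ge2 c_gt0 I ww) // ij.
rewrite (ess_imgE I g ww) lerB ?gle //.
  by apply: (child_pt_le n_ge2 c_gt0 I ww); [exact: leq_trans ij|rewrite jn leqnn].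
by apply: (child_pt_le n_ge2 c_gt0 I ww); rewrite // i1 (leq_trans ij jn).
Qed.

(** The gap in a slot may be long compared with [r]. Its mass is that of the child, so the mass
    bound is applied to the hull of the child instead. *)
Lemma child_mass_le k w A B j r : weighted k w A B -> (1 <= j <= n k.+1)%N ->
  g (hi I (rcons w j)) - g (lo I (rcons w j)) <= M * r ->
  cut w A B j.+1 - cut w A B j <= C * M `^ s * r `^ s.
Proof.
move=> wt jn hr; have [ww _] := weighted_word n_ge2 c_gt0 gq wt.
have wt' := WeightedS wt jn; have ww' := word_rcons ww jn.
have M0 : 0 < M by case: gq.
have [sub1 sub2] := ess_sub n_ge2 c_gt0 I ww'.
have E0 := ess_img_gt0 n_ge2 c_gt0 I gq ww'.
have Er : ess_img (rcons w j) <= M * r.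
  apply: le_trans hr; rewrite (ess_imgE I g ww') lerB ?gle //.
have r0 : 0 <= r by rewrite -(pmulr_rge0 _ M0) (le_trans (ltW E0)).
apply: le_trans (massC wt') _; rewrite -mulrA ler_pM2l // -powRM // ?(ltW M0) //.
by apply: powR_homo => //; apply: ltW.
Qed.

Let C2 : R := C * (1 + M `^ s).

(** As long as the next letter is 1 the left ends of the mass intervals agree, and one descends. At
    the first other letter [j], the mass before [t] is at most that of the slots before [j] plus
    that of slot [j]. [m] limits the descent and leaves the mass of a word of length [k + m]. *)
Lemma address_left_le (t : R) k m : 0 <= t < 1 ->
  t - lb t k <= C2 * (g (address_pt t) - g (lo I (wd t k))) `^ s +
                (rb t (k + m) - lb t (k + m)).
Proof.
move=> t01; elim: m k => [|m IH] k.
  have [_ /andP[_ tB] _] := address_next k t01.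
  rewrite addn0; have : 0 <= C2 * (g (address_pt t) - g (lo I (wd t k))) `^ s.
    by rewrite mulr_ge0 ?powR_ge0 // mulr_ge0 ?(ltW C0) // addr_ge0 ?powR_ge0.
  lra.
have [wt _ [j jn [nextE /andP[_ tj]]]] := address_next k t01.
have ww := address_word k t01.
have /andP[lx _] := address_ptP k t01.
have /andP[lx' _] := address_ptP k.+1 t01.
have := IH k.+1; rewrite addSnnS; set rest := rb t (k + m.+1) - lb t (k + m.+1).
have rest0 : 0 <= rest.
  have [_] := weighted_word n_ge2 c_gt0 gq (address_weighted (k + m.+1) t01).
  by rewrite /rest => /ltW; rewrite subr_ge0.
rewrite nextE /= in lx' *; move: jn tj nextE lx'.
set w := wd t k in ww wt lx *; set A := lb t k in wt *; set B := rb t k in wt *.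
move=> jn0 tj _ lx' IHk; have [lsub _] := child_sub c_gt0 I ww jn0.
have /andP[j1 jn] := jn0.
have M0 : 0 < M by case: gq.
move: j1; rewrite leq_eqVlt => /predU1P[j1|j2].
  move: IHk lx' lsub; rewrite -j1 cut_first => /le_trans + lx' lsub; apply.
  rewrite lerD2r ler_wpM2l ?mulr_ge0 ?addr_ge0 ?powR_ge0 ?(ltW C0) //.
  by apply: powR_homo; rewrite ?subr_ge0 ?gle // lerB // gle.
have j1 := ltnW j2; have j1n : (1 <= j <= n k.+1)%N by rewrite j1.
set r := g (address_pt t) - g (lo I w).
have p1 : lo I w <= child_pt w 1 by have [] := ess_sub n_ge2 c_gt0 I ww.
have pjE : child_pt w j = lo I (rcons w j) := child_pt_lo I ww jn.
have first_le : cut w A B j - cut w A B 1 <= C * r `^ s.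
  apply: cut_diff_le wt _ _ _ => //; first by rewrite j1 leqW.
  by rewrite pjE lerB // gle.
have jE : j.-1.+1 = j by rewrite prednK.
have second_le : cut w A B j.+1 - cut w A B j <= C * M `^ s * r `^ s.
  apply: (child_mass_le wt j1n).
  have jp : (1 <= j.-1 <= n k.+1)%N by rewrite -ltnS jE j2 (leq_trans (leq_pred _)).
  have prev : child_pt w j.-1 < child_pt w j.
    by apply: (child_pt_lt n_ge2 c_gt0 I ww); [case/andP: jp|rewrite jE leqnn leqW].
  (* Child [j] is no longer than slot [j - 1], which lies between the left end of the parent and the
     point. *)
  have [_ adj] := line_qs_adjacent (hi I (rcons w j)) gq prev.
  rewrite -pjE; apply: le_trans (adj _) _.
    rewrite (child_len c_gt0 I ww j1n) addrAC subrr add0r.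
    have := child_hi_le I ww jp; rewrite (child_len c_gt0 I ww jp) jE; lra.
  rewrite ler_pM2l // /r pjE lerB ?gle //; apply: le_trans p1 _.
  apply: (child_pt_le n_ge2 c_gt0 I ww) => //; case/andP: jp => -> jp /=.
  exact: leqW.
rewrite cut_first in first_le; rewrite /C2 mulrDr mulr1 mulrDl; lra.
Qed.

(** The mirror argument, descending along last letters. Slots carry their gap on the right, so child
    [j] is now compared with the stretch from its right end to [child_pt w j.+2], which contains
    child [j + 1]. *)
Lemma address_right_le (t : R) k m : 0 <= t < 1 ->
  rb t k - t <= C2 * (g (hi I (wd t k)) - g (address_pt t)) `^ s +
                (rb t (k + m) - lb t (k + m)).
Proof.
move=> t01; elim: m k => [|m IH] k.
  have [_ /andP[At _] _] := address_next k t01.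
  rewrite addn0; have : 0 <= C2 * (g (hi I (wd t k)) - g (address_pt t)) `^ s.
    by rewrite mulr_ge0 ?powR_ge0 // mulr_ge0 ?(ltW C0) // addr_ge0 ?powR_ge0.
  lra.
have [wt _ [j jn0 [nextE /andP[tj _]]]] := address_next k t01.
have ww := address_word k t01.
have /andP[_ xh] := address_ptP k t01.
have /andP[_ xh'] := address_ptP k.+1 t01.
have := IH k.+1; rewrite addSnnS; set rest := rb t (k + m.+1) - lb t (k + m.+1).
have rest0 : 0 <= rest.
  have [_] := weighted_word n_ge2 c_gt0 gq (address_weighted (k + m.+1) t01).
  by rewrite /rest => /ltW; rewrite subr_ge0.
rewrite nextE /= in xh' *; move: jn0 tj nextE xh'.
set w := wd t k in ww wt xh *; set A := lb t k in wt *; set B := rb t k in wt *.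
move=> jn0 tj _ xh' IHk; have [_ hsub] := child_sub c_gt0 I ww jn0.
have /andP[j1 jn] := jn0.
have M0 : 0 < M by case: gq.
move: jn; rewrite leq_eqVlt => /predU1P[jn|jn].
  move: IHk xh' hsub; rewrite jn (cut_last n_ge2 c_gt0 I gq A B ww).
  move=> /le_trans + xh' hsub; apply.
  rewrite lerD2r ler_wpM2l ?mulr_ge0 ?addr_ge0 ?powR_ge0 ?(ltW C0) //.
  by apply: powR_homo; rewrite ?subr_ge0 ?gle // lerB // gle.
set r := g (hi I w) - g (address_pt t).
have pn : child_pt w (n k.+1).+1 <= hi I w by have [] := ess_sub n_ge2 c_gt0 I ww.
have hj := child_hi_le I ww jn0.
have first_le : cut w A B (n k.+1).+1 - cut w A B j.+1 <= C * r `^ s.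
  apply: cut_diff_le wt _ _ _ => //; first by rewrite leqnn andbT ltnS ltnW.
  by rewrite lerB // gle // (le_trans xh').
have second_le : cut w A B j.+1 - cut w A B j <= C * M `^ s * r `^ s.
  apply: (child_mass_le wt jn0).
  have jS : (1 <= j.+1 <= n k.+1)%N by [].
  have lt := moran_lo_lt_hi c_gt0 I (word_rcons ww jn0).
  have [adj _] := line_qs_adjacent (child_pt w j.+2) gq lt.
  apply: le_trans (adj _) _.
    have := child_hi_le I ww jS; rewrite (child_len c_gt0 I ww jS).
    have := child_len c_gt0 I ww jn0; rewrite (child_pt_lo I ww (ltnW jn)); lra.
  rewrite ler_pM2l // /r lerB ?gle //; apply: le_trans pn.
  by apply: (child_pt_le n_ge2 c_gt0 I ww); rewrite // leqnn andbT ltnS.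
rewrite (cut_last n_ge2 c_gt0 I gq A B ww) in first_le.
by rewrite /C2 mulrDr mulr1 mulrDl; lra.
Qed.

(** At the first level where the addresses differ, with letters [i < j], the distance [u - t] splits
    at [cut i.+1] and [cut j] into three parts, each controlled by the [g]-distance of the two
    points. *)
Lemma address_pt_holder_lt (t u : R) : 0 <= t < 1 -> 0 <= u < 1 -> t < u ->
  u - t <= (C + 2 * C2) * `|g (address_pt u) - g (address_pt t)| `^ s.
Proof.
move=> t01 u01 tu.
(* Equal addresses would put [t] and [u] into common mass intervals of arbitrarily small length. *)
have [differ|same] := pselect (exists k, address t k != address u k); last first.
  have ut0 : 0 < (u - t) / 2 by rewrite divr_gt0 // subr_gt0.
  have [k hk] := mass0 ut0; exfalso.
  have tuk : address t k = address u k.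
    by apply/eqP; apply: contrapT => /negP h; apply: same; exists k.
  have [wt /andP[At tB] _] := address_next k t01.
  have [_ /andP[Au uB] _] := address_next k u01.
  by have := hk _ _ _ _ (leqnn k) wt; rewrite -tuk in uB; lra.
have [k differ_k min_k] := ex_minnP differ.
case: k differ_k min_k => [|k]; first by rewrite eqxx.
move=> differ_k min_k.
have same_k : address t k = address u k.
  by apply/eqP; apply: contraT => /min_k; rewrite ltnn.
have [wt _ [i in_ [tE /andP[it ti]]]] := address_next k t01.
have [_ _ [j jn [uE /andP[uj ju]]]] := address_next k u01.
have ww := address_word k t01.
rewrite -same_k in uE uj ju.
have /andP[_ xh] := address_ptP k.+1 t01; have /andP[ly _] := address_ptP k.+1 u01.
have right_le m := address_right_le k.+1 m t01.
have left_le m := address_left_le k.+1 m u01.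
rewrite tE /= in xh right_le; rewrite uE /= in ly left_le.
move: wt ww it ti uj ju xh ly right_le left_le differ_k; rewrite tE uE.
set w := wd t k; set A := lb t k; set B := rb t k.
move=> wt ww it ti uj ju xh ly right_le left_le differ_k.
have /andP[i1 im] := in_; have /andP[j1 jm] := jn.
have [_ AB0] := weighted_word n_ge2 c_gt0 gq wt.
have cut_mono a b : (1 <= a)%N -> (a <= b <= (n k.+1).+1)%N -> cut w A B a <= cut w A B b.
  move=> a1 ab; rewrite -subr_ge0 cutB mulr_ge0 ?subr_ge0 ?(ltW AB0) //.
  rewrite divr_ge0 ?(ltW (ess_img_gt0 n_ge2 c_gt0 I gq ww)) // subr_ge0 gle //.
  exact: (child_pt_le n_ge2 c_gt0 I ww).
have ij : (i < j)%N.
  rewrite ltn_neqAle; apply/andP; split.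
    by apply: contraNneq differ_k => ->.
  rewrite leqNgt; apply/negP => ji.
  have := cut_mono j.+1 i (isT : (0 < j.+1)%N); rewrite ji (leqW im) => /(_ isT).
  lra.
have hiE := child_hi_le I ww in_.
have pjE := child_pt_lo I ww jm.
have pij : child_pt w i.+1 <= child_pt w j.
  by apply: (child_pt_le n_ge2 c_gt0 I ww); rewrite // ij leqW.
have xy : address_pt t <= address_pt u.
  by rewrite (le_trans xh) // (le_trans hiE) // (le_trans pij) // pjE.
rewrite ger0_norm ?subr_ge0 ?gle //.
set r := g (address_pt u) - g (address_pt t).
have mid : cut w A B j - cut w A B i.+1 <= C * r `^ s.
  apply: cut_diff_le wt _ _ _ => //; first by rewrite ij leqW.
  by rewrite lerB // gle // ?pjE // (le_trans xh).
have C20 : 0 <= C2 by rewrite mulr_ge0 ?(ltW C0) // addr_ge0 ?powR_ge0.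
have left' : u - cut w A B j <= C2 * r `^ s.
  (* The leftover mass in [left_le] tends to 0 with the depth of the descent. *)
  apply/ler_addgt0Pr => d d0; have [m hm] := mass0 d0.
  apply: le_trans (left_le m) _; apply: lerD.
    rewrite ler_wpM2l //; apply: powR_homo; first by rewrite subr_ge0 gle.
    by rewrite lerB // gle // (le_trans xh) // (le_trans hiE) // -pjE.
  by apply: hm (address_weighted (k.+1 + m) u01); rewrite leq_addl.
have right' : cut w A B i.+1 - t <= C2 * r `^ s.
  apply/ler_addgt0Pr => d d0; have [m hm] := mass0 d0.
  apply: le_trans (right_le m) _; apply: lerD.
    rewrite ler_wpM2l //; apply: powR_homo; first by rewrite subr_ge0 gle.
    by rewrite lerB // gle // (le_trans hiE) // (le_trans pij) // pjE.
  by apply: hm (address_weighted (k.+1 + m) t01); rewrite leq_addl.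
lra.
Qed.

End moran_address.

(** * Proof of the theorem *)

Lemma mdist_line {R : realType} (x y : R) : @mdist R R^o x y = `|x - y|.
Proof. by rewrite /mdist /= distrC. Qed.

(** A continuous injection of the line is strictly monotone, so [g] is [f] or [- f]. Triples with
    [x] midway between [a] and [b] have ratio 1, whence the constant [eta 1]. *)
Lemma quasisymmetric_line_qs {R : realType} (f : R^o -> R^o) : quasisymmetric f ->
  exists (g : R -> R) (M : R), line_qs M g /\ forall x y : R, `|f x - f y| = `|g x - g y|.
Proof.
move=> [[h [_ fK _ fc _]] [eta [_ etaP]]].
have finj : injective f by move=> x y /(congr1 h); rewrite !fK.
have fc' : {within [set` `]-oo, +oo[%R], continuous (f : R -> R)}.
  by rewrite set_itvNyy.
have finj' : {in `]-oo, +oo[%R &, injective (f : R -> R)} by move=> x y _ _; apply: finj.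
have ratio (a b x : R) : a <> b -> a <> x -> b <> x -> `|x - a| = `|x - b| ->
    `|f x - f a| <= eta 1 * `|f x - f b|.
  move=> ab ax bx e; have := etaP a b x ab ax bx.
  have xb0 : 0 < `|x - b| by rewrite normr_gt0 subr_eq0; apply/eqP => xb; apply: bx.
  have fxb0 : 0 < `|f x - f b|.
    by rewrite normr_gt0 subr_eq0; apply/eqP => /finj xb; apply: bx.
  by rewrite !mdist_line e divff ?gt_eqF // ler_pdivrMr.
have bounds (g : R -> R) : {homo g : x y / x < y} ->
    (forall x y : R, `|f x - f y| = `|g x - g y|) -> line_qs (eta 1) g.
  move=> gi fg.
  have sides x d : 0 < d ->
      g (x + d) - g x <= eta 1 * (g x - g (x - d)) /\
      g x - g (x - d) <= eta 1 * (g (x + d) - g x).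
    move=> d0; have g1 : g x < g (x + d) by apply: gi; lra.
    have g2 : g (x - d) < g x by apply: gi; lra.
    have e1 : x + d <> x - d by move=> e; lra.
    have e2 : x + d <> x by move=> e; lra.
    have e3 : x - d <> x by move=> e; lra.
    have eq1 : `|x - (x + d)| = `|x - (x - d)|.
      by rewrite opprD addrA subrr sub0r normrN; congr `|_|; ring.
    have r1 := ratio _ _ _ e1 e2 e3 eq1.
    have r2 := ratio _ _ _ (fun e => e1 (esym e)) e3 e2 (esym eq1).
    have a1 : `|f x - f (x + d)| = g (x + d) - g x.
      by rewrite fg distrC gtr0_norm ?subr_gt0.
    have a2 : `|f x - f (x - d)| = g x - g (x - d).
      by rewrite fg gtr0_norm ?subr_gt0.
    by rewrite a1 a2 in r1 r2.
  (* Positivity of [eta 1] is read off one instance in which both increments are positive. *)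
  split=> //; have [h1 _] := sides 0 1 ltr01.
  have p1 : 0 < g (0 + 1) - g 0 by rewrite subr_gt0; apply: gi; lra.
  have p2 : 0 < g 0 - g (0 - 1) by rewrite subr_gt0; apply: gi; lra.
  by rewrite -(pmulr_lgt0 _ p2) (lt_le_trans p1).
have [fi|fd] := itv_continuous_inj_mono fc' finj'.
  exists f, (eta 1); split=> //; apply: bounds => // x y xy.
  by apply: fi xy; rewrite in_itv.
exists (fun x => - f x), (eta 1); split; last first.
  by move=> x y; rewrite -opprD normrN.
apply: bounds => x y; last by rewrite -opprD normrN.
by move=> xy; rewrite ltrN2; apply: fd xy; rewrite in_itv.
Qed.

Section main.
Context (R : realType) (n : nat -> nat) (c : nat -> R).
Context (n_ge2 : forall k, (1 <= k)%N -> (2 <= n k)%N).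
Context (c_gt0 : forall k, (1 <= k)%N -> 0 < c k).
Context (nc_lt1 : forall k, (1 <= k)%N -> (n k)%:R * c k < 1).
Context (I : moran_family n c).

(** This is where the assumption on the end gaps enters: it makes the hull length a function of the
    level. *)
Lemma end_gaps_ess (l r : nat -> R) :
  (forall k s, word n k s -> gap I s 0 = l k.+1 /\ gap I s (n k.+1) = r k.+1) ->
  forall k s, word n k s ->
    child_pt I s (n k.+1).+1 - child_pt I s 1 = moran_len c k - l k.+1 - r k.+1.
Proof.
move=> lr k s ws; have [<- <-] := lr k s ws.
have m0 : (0 < n k.+1)%N by rewrite (leq_trans _ (n_ge2 (ltn0Sn k))).
rewrite /gap eqxx (gtn_eqF m0) (word_size ws) eqxx.
by rewrite (child_pt_last I ws) (child_pt_lo I ws m0) -(moran_itv_len c_gt0 I ws); ring.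
Qed.

Context (ess : nat -> R).
Context (essE : forall k s, word n k s ->
  child_pt I s (n k.+1).+1 - child_pt I s 1 = ess k).
Context (AB : (exists2 w1 : R, 0 < w1 &
           forall k, (1 <= k)%N -> alpha_max I k <= w1 * alpha_min I k) \/
        (exists2 w2 : R, 0 < w2 &
           forall k, (1 <= k)%N -> alpha_max I k <= w2 * moran_len c k)).
Context (dimE : hausdorff_dim (moran_set I) = 1%E).

Lemma moran_image_dim (f : R^o -> R^o) : quasisymmetric f ->
  hausdorff_dim (f @` moran_set I) = 1%E.
Proof.
move=> /quasisymmetric_line_qs[g [M [gq fg]]].
apply/eqP; rewrite eq_le; apply/andP; split.
  (* Upper bound: [E] lies in the unit interval, so the image stays within [g 1 - g 0] of [f 0]. *)
  have D0 : 0 < g 1 - g 0 by rewrite subr_gt0; case: gq => _ gi _; apply: gi; lra.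
  apply: (@hausdorff_dim_le1 _ _ (f 0 - (g 1 - g 0)) (f 0 + (g 1 - g 0))); first lra.
  move=> _ [x Ex <-]; have [_ /size0nil-> +] : exists2 w, size w = 0%N & moran_itv I w x.
    by have [w [w0 _] xw] := Ex 0%N Logic.I; exists w.
  have [l0 h1] := moran_root I; rewrite /moran_itv /= in_itv /= l0 h1 => /andP[x0 x1].
  have : `|f x - f 0| <= g 1 - g 0.
    by rewrite fg ger0_norm ?subr_ge0 ?lerB ?(line_qs_le gq).
  by rewrite in_itv /= ler_norml; lra.
apply: le_hausdorff_dim => s s01.
have [C C0 hC] := weighted_le_img n_ge2 c_gt0 nc_lt1 AB essE gq dimE s01.
have small := weighted_small n_ge2 c_gt0 nc_lt1 AB essE gq dimE.
have holder := address_pt_holder_lt n_ge2 c_gt0 gq s01 C0 hC small.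
set C' := C + _ in holder.
have C'0 : 0 < C'.
  have := powR_ge0 M s; rewrite /C' => M0; rewrite ltr_wpDr // mulr_ge0 // mulr_ge0 ?(ltW C0) //.
  lra.
have s0 : 0 < s by case/andP: s01.
apply: lt_le_trans (@mass_distribution _ _ s C' (f @` moran_set I)
  (fun t => f (address_pt I g t)) s0 C'0 _ _).
- by rewrite lte_fin invr_gt0.
- by move=> t t01; exists (address_pt I g t) => //; apply: (address_pt_moran n_ge2 c_gt0 I gq).
- move=> t u t01 u01; rewrite mdist_line fg.
  wlog tu : t u t01 u01 / t < u => [hwlog|].
    have [tu|ut|->] := ltgtP t u; first exact: hwlog.
      by rewrite distrC [`|g _ - _|]distrC; apply: hwlog.
    by rewrite subrr normr0 mulr_ge0 ?powR_ge0 // ltW.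
  rewrite distrC gtr0_norm ?subr_gt0 //.
  by rewrite [`|g _ - _|]distrC; apply: holder.
Qed.

End main.

Theorem theorem2 (R : realType) (n : nat -> nat) (c : nat -> R)
  (n_ge2 : forall k, (1 <= k)%N -> (2 <= n k)%N)
  (c_gt0 : forall k, (1 <= k)%N -> 0 < c k)
  (nc_lt1 : forall k, (1 <= k)%N -> (n k)%:R * c k < 1)
  (I : moran_family n c)
  (end_gaps : exists l r : nat -> R,
    (forall k, (1 <= k)%N -> 0 <= l k /\ 0 <= r k) /\
    forall k s, word n k s ->
      gap I s 0 = l k.+1 /\ gap I s (n k.+1) = r k.+1)
  (dimE : hausdorff_dim (moran_set I) = 1%E)
  (AB : (exists2 w1 : R, 0 < w1 &
           forall k, (1 <= k)%N -> alpha_max I k <= w1 * alpha_min I k) \/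
        (exists2 w2 : R, 0 < w2 &
           forall k, (1 <= k)%N ->
             alpha_max I k <= w2 * \prod_(1 <= j < k.+1) c j)) :
  (forall f : R^o -> R^o, quasisymmetric f ->
     hausdorff_dim (f @` moran_set I) = 1%E) /\
  qs_hausdorff_minimal (moran_set I).
Proof.
have dim1 (f : R^o -> R^o) : quasisymmetric f ->
    hausdorff_dim (f @` moran_set I) = 1%E.
  have [l [r [_ lr]]] := end_gaps.
  exact: (moran_image_dim n_ge2 c_gt0 nc_lt1 (end_gaps_ess n_ge2 c_gt0 lr) AB dimE).
by split=> // f /dim1 ->; rewrite dimE.
Qed.
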